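(* Assume the setting and standing assumptions described in the context. Assume moreover that $\operatorname{Im}\mathbb{B}$ is closed in $\mathcal{Q}'$ and that there exists $\beta>0$ such that $$\sup_{v\in\mathcal{V}\setminus\{0\}}\frac{b(v,q)}{\|v\|_{\mathcal{V}}}\ge\beta\|q\|_{\mathcal{Q}}\quad\forall q\in\mathcal{H}^{\perp},\qquad \sup_{q\in\mathcal{Q}\setminus\{0\}}\frac{b(v,q)}{\|q\|_{\mathcal{Q}}}\ge\beta\|v\|_{\mathcal{V}}\quad\forall v\in\mathcal{K}^{\perp}.$$ Then for all $f\in L^1_{\mathcal{J}}(\mathcal{V}')$ and $g\in L^1_{\mathcal{J}}(\mathcal{Q}')$ there is a unique $(u,p)\in L^1_{\mathcal{J}}(\mathcal{V}\times\mathcal{Q})$ such that, for a.e. $t\in\mathcal{J}$ and all $(v,q)\in\mathcal{V}\times\mathcal{Q}$, $$\begin{aligned}a(u(t),v)+b(v,p(t))&=\langle f(t),v\rangle_{\mathcal{V}}+\int_0^t\big[k_1(t,s)a(u(s),v)+k_2(t,s)b(v,p(s))\big]ds,\\ b(u(t),q)-c(p(t),q)&=\langle g(t),q\rangle_{\mathcal{Q}}+\int_0^t\big[k_3(t,s)b(u(s),q)-k_4(t,s)c(p(s),q)\big]ds,\end{aligned}$$ and it satisfies $$\|u\|_{L^1_{\mathcal{J}}(\mathcal{V})}+\|p\|_{L^1_{\mathcal{J}}(\mathcal{Q})}\le C\big(\|f\|_{L^1_{\mathcal{J}}(\mathcal{V}')}+\|g\|_{L^1_{\mathcal{J}}(\mathcal{Q}')}\big),$$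 where $C$ is a positive constant depending on $\alpha_0,\beta,\gamma_0$, the continuity constants $\|a\|,\|c\|$, the kernel constants $C_{k_i}$, $i=1,2,3,4$, and $T$. Moreover, there exist positive constants $C_1,\dots,C_{16}$, independent of $f$ and $g$, such that $$\|\overline{u}\|_{L^1_{\mathcal{J}}(\mathcal{V})}\le C_9\|\overline{f}\|_{L^1_{\mathcal{J}}(\mathcal{V}')}+C_{13}\|f_0\|_{L^1_{\mathcal{J}}(\mathcal{V}')}+C_3\|\overline{g}\|_{L^1_{\mathcal{J}}(\mathcal{Q}')}+C_7\|g_0\|_{L^1_{\mathcal{J}}(\mathcal{Q}')},$$ $$\|u_0\|_{L^1_{\mathcal{J}}(\mathcal{V})}\le C_{10}\|\overline{f}\|_{L^1_{\mathcal{J}}(\mathcal{V}')}+C_{14}\|f_0\|_{L^1_{\mathcal{J}}(\mathcal{V}')}+C_4\|\overline{g}\|_{L^1_{\mathcal{J}}(\mathcal{Q}')}+C_8\|g_0\|_{L^1_{\mathcal{J}}(\mathcal{Q}')},$$ $$\|\overline{p}\|_{L^1_{\mathcal{J}}(\mathcal{Q})}\le C_{11}\|\overline{f}\|_{L^1_{\mathcal{J}}(\mathcal{V}')}+C_{15}\|f_0\|_{L^1_{\mathcal{J}}(\mathcal{V}')}+C_1\|\overline{g}\|_{L^1_{\mathcal{J}}(\mathcal{Q}')}+C_5\|g_0\|_{L^1_{\mathcal{J}}(\mathcal{Q}')},$$ $$\|p_0\|_{L^1_{\mathcal{J}}(\mathcal{Q})}\le C_{12}\|\overline{f}\|_{L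^1_{\mathcal{J}}(\mathcal{V}')}+C_{16}\|f_0\|_{L^1_{\mathcal{J}}(\mathcal{V}')}+C_2\|\overline{g}\|_{L^1_{\mathcal{J}}(\mathcal{Q}')}+C_6\|g_0\|_{L^1_{\mathcal{J}}(\mathcal{Q}')}.$$
   Context: $\mathcal{V},\mathcal{Q}$ are real Hilbert spaces with duals $\mathcal{V}',\mathcal{Q}'$ and duality pairings $\langle\cdot,\cdot\rangle_{\mathcal{V}},\langle\cdot,\cdot\rangle_{\mathcal{Q}}$. $\mathcal{J}=[0,T]$ with $T\in[0,\infty)$. For a Banach space $\mathcal{B}$ and $1\le\ell\le\infty$, $L^\ell_{\mathcal{J}}(\mathcal{B})$ is the usual Bochner space $L^\ell(\mathcal{J};\mathcal{B})$ with its usual norm. Let $a:\mathcal{V}\times\mathcal{V}\to\mathbb{R}$, $b:\mathcal{V}\times\mathcal{Q}\to\mathbb{R}$, $c:\mathcal{Q}\times\mathcal{Q}\to\mathbb{R}$ be continuous bilinear forms with norms (continuity constants) $\|a\|,\|b\|,\|c\|$. $\mathbb{B}:\mathcal{V}\to\mathcal{Q}'$ is defined by $\langle\mathbb{B}v,q\rangle_{\mathcal{Q}}=b(v,q)$, with transpose $\mathbb{B}^*:\mathcal{Q}\to\mathcal{V}'$. Set $\mathcal{K}=\ker\mathbb{B}\subset\mathcal{V}$ and $\mathcal{H}=\ker\mathbb{B}^*\subset\mathcal{Q}$, with orthogonal complements $\mathcal{K}^\perp,\mathcal{H}^\perp$. Standing assumptions: $a$ and $c$ are symmetric and positive semi-definite,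 and there are $\alpha_0,\gamma_0>0$ with $a(v_0,v_0)\ge\alpha_0\|v_0\|_{\mathcal{V}}^2$ for all $v_0\in\mathcal{K}$ and $c(q_0,q_0)\ge\gamma_0\|q_0\|_{\mathcal{Q}}^2$ for all $q_0\in\mathcal{H}$. The kernels $k_i$, $i=1,2,3,4$, are continuous real functions on the triangle $\{(t,s):0\le s\le t\le T\}$ with $|k_i(t,s)|\le C_{k_i}$. Splittings: $u=u_0+\overline{u}$ with $u_0\in\mathcal{K}$, $\overline{u}\in\mathcal{K}^\perp$; $p=p_0+\overline{p}$ with $p_0\in\mathcal{H}$, $\overline{p}\in\mathcal{H}^\perp$ (pointwise a.e. in time). Correspondingly $f=f_0+\overline{f}$, where for $v=v_0+\overline{v}$ one has $\langle f_0,v\rangle_{\mathcal{V}}=\langle f,v_0\rangle_{\mathcal{V}}$ and $\langle\overline{f},v\rangle_{\mathcal{V}}=\langle f,\overline{v}\rangle_{\mathcal{V}}$; similarly $g=g_0+\overline{g}$ with respect to $\mathcal{Q}=\mathcal{H}\oplus\mathcal{H}^\perp$. *)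

(* Defs.v *)
From HB Require Import structures.
From mathcomp Require Import all_boot all_order all_algebra.
From mathcomp Require Import ring lra.
From mathcomp Require Import all_classical all_reals all_analysis.

Set Implicit Arguments.
Unset Strict Implicit.
Unset Printing Implicit Defensive.

Import Order.TTheory GRing.Theory Num.Theory.
Import numFieldNormedType.Exports.

Local Open Scope classical_set_scope.
Local Open Scope ring_scope.

(* Real Hilbert spaces: Banach spaces whose norm comes from an inner product. *)
HB.mixin Record CompleteNormedModule_isHilbert (R : realType) V
    of CompleteNormedModule R V := {
  inner : V -> V -> R;
  innerC : forall x y, inner x y = inner y x;
  innerPl : forall (k : R) x y z,
    inner (k *: x + y) z = k * inner x z + inner y z;
  inner_normE : forall x, inner x x = `|x| ^+ 2
}.

#[short(type="hilbertType")]
HB.structure Definition Hilbert (R : realType) :=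
  {V of CompleteNormedModule R V & CompleteNormedModule_isHilbert R V}.

(* The dual [V'] with the operator norm; the duality pairing is application. *)
Section Dual.
Context {R : realType} {V : normedModType R}.

Definition dual_pred : {pred V -> R} :=
  mem [set f : V -> R | linear f /\ continuous f].

Lemma dual_predE (f : V -> R) :
  (f \in dual_pred) <-> (linear f /\ continuous f).
Proof. by split=> [/set_mem|?]; last exact/mem_set. Qed.

Lemma dual_pred_submod : submod_closed dual_pred.
Proof.
split=> [|k f g /dual_predE[lf cf] /dual_predE[lg cg]]; apply/dual_predE.
  split=> [k x y|x]; first by rewrite /GRing.zero/= scaler0 addr0.
  exact: cst_continuous.
split=> [l x y|x].
  rewrite /GRing.add/= /GRing.scale/= lf lg /GRing.scale/=.
  by rewrite !mulrDr addrACA !mulrA (mulrC k l).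
exact: (@cvgD _ _ _ _ _ (fun y => k *: f y) g _ _ (cvgZl_tmp (cf x)) (cg x)).
Qed.

HB.instance Definition _ :=
  GRing.isSubmodClosed.Build R (V -> R) dual_pred dual_pred_submod.
End Dual.
Arguments dual_pred {R} V.

Section DualType.
Context {R : realType}.
Record topdual (V : normedModType R) := Dual {
  dual_val :> V -> R;
  dual_valP : dual_val \in dual_pred V
}.
End DualType.
HB.instance Definition _ (R : realType) (V : normedModType R) :=
  [isSub for @dual_val R V].
HB.instance Definition _ (R : realType) (V : normedModType R) :=
  [Choice of topdual V by <:].
HB.instance Definition _ (R : realType) (V : normedModType R) :=
  [SubChoice_isSubLmodule of topdual V by <:].

Section DualNorm.
Context {R : realType} {V : normedModType R}.
Implicit Types phi psi : topdual V.

Lemma dual_linear phi : linear phi.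
Proof. by have /dual_predE[] := dual_valP phi. Qed.

Lemma dual_continuous phi : continuous (phi : V -> R).
Proof. by have /dual_predE[] := dual_valP phi. Qed.

HB.instance Definition _ phi :=
  GRing.isLinear.Build R V R _ (dual_val phi) (dual_linear phi).

Lemma dualP phi psi : (forall v, phi v = psi v) -> phi = psi.
Proof. by move=> h; apply/val_inj/funext. Qed.

Definition dual_norm phi : R := sup [set `|phi v| | v in [set v | `|v| <= 1]].

Lemma dual_norm_has_sup phi :
  has_sup [set `|phi v| | v in [set v : V | `|v| <= 1]].
Proof.
split; first by exists `|phi 0|; exists 0 => //=; rewrite normr0.
have /linear_boundedP/pinfty_ex_gt0[r r0 hr] :
    bounded_near (phi : V -> R) (nbhs (0 : V)).
  exact/(continuous_linear_bounded _ (@dual_continuous phi 0)).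
exists r => _ [v /= v1 <-]; apply: le_trans (hr v) _.
by rewrite ler_piMr// ltW.
Qed.

Lemma dual_norm_ub phi v : `|phi v| <= dual_norm phi * `|v|.
Proof.
have [->|v0] := eqVneq v 0; first by rewrite linear0 !normr0 mulr0.
have nv : 0 < `|v| by rewrite normr_gt0.
rewrite -ler_pdivrMr//; apply: sup_upper_bound; first exact: dual_norm_has_sup.
exists (`|v|^-1 *: v) => /=.
  by rewrite normrZ normfV normr_id mulVf ?gt_eqF.
by rewrite linearZ/= normrM normfV normr_id mulrC.
Qed.

Lemma dual_norm_le phi (M : R) :
  (forall v, `|v| <= 1 -> `|phi v| <= M) -> dual_norm phi <= M.
Proof.
move=> h; apply: ge_sup; first by have [] := dual_norm_has_sup phi.
by move=> _ [v /= v1 <-]; exact: h.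
Qed.

Lemma dual_norm_ge0 phi : 0 <= dual_norm phi.
Proof.
apply: (le_trans (normr_ge0 (phi 0))).
by apply: sup_upper_bound; [exact: dual_norm_has_sup|exists 0 => //=; rewrite normr0].
Qed.

Lemma dual_norm_unit phi v : `|v| <= 1 -> `|phi v| <= dual_norm phi.
Proof.
by move=> v1; apply: le_trans (dual_norm_ub _ _) _; rewrite ler_piMr ?dual_norm_ge0.
Qed.

Lemma dual_normD phi psi : dual_norm (phi + psi) <= dual_norm phi + dual_norm psi.
Proof.
apply: dual_norm_le => v v1; apply: le_trans (ler_normD _ _) _.
by rewrite lerD// dual_norm_unit.
Qed.

Lemma dual_normZ (k : R) phi : dual_norm (k *: phi) = `|k| * dual_norm phi.
Proof.
have le l chi : dual_norm (l *: chi) <= `|l| * dual_norm chi.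
  apply: dual_norm_le => v v1.
  by rewrite [X in `|X|](_ : _ = l * chi v)// normrM ler_wpM2l// dual_norm_unit.
apply/eqP; rewrite eq_le le/=.
have [->|k0] := eqVneq k 0; first by rewrite normr0 mul0r dual_norm_ge0.
rewrite -ler_pdivlMl ?normr_gt0// -normfV.
by have := le k^-1 (k *: phi); rewrite scalerA mulVf// scale1r.
Qed.

Lemma dual_norm0_eq0 phi : dual_norm phi = 0 -> phi = 0.
Proof.
move=> h; apply: dualP => v; apply/eqP; rewrite -normr_le0.
by have := dual_norm_ub phi v; rewrite h mul0r.
Qed.
End DualNorm.

HB.instance Definition _ (R : realType) (V : normedModType R) :=
  Lmodule_isNormed.Build R (topdual V)
    (@dual_normD R V) (@dual_normZ R V) (@dual_norm0_eq0 R V).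

Record cbilinear (R : realType) (V W : normedModType R) := CBilinear {
  cbil_val :> {bilinear V -> W -> R};
  cbil_continuous : continuous (fun z : V * W => cbil_val z.1 z.2)
}.

Definition bilinear_norm (R : realType) (V W : normedModType R)
    (b : cbilinear V W) : R :=
  sup [set `|b z.1 z.2| | z in [set z : V * W | `|z.1| <= 1 /\ `|z.2| <= 1]].

Section Operators.
Context {R : realType} {V W : normedModType R}.
Variable b : cbilinear V W.

Lemma cbil_dual v : b v \in dual_pred W.
Proof.
apply/dual_predE; split=> [k x y|w]; first by rewrite linearPr.
have := @cbil_continuous _ _ _ b (v, w).
move=> h; apply: (@continuous_comp _ _ _ (fun w => (v, w)) (fun z => b z.1 z.2)) => //.
by apply: cvg_pair => //=; exact: cvg_cst.
Qed.

(* The operator B : V -> Q' of the form b, with <B v, q> = b(v, q). *)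
Definition opB (v : V) : topdual W := Dual (cbil_dual v).

Definition transp_val (w : W) (v : V) : R := b v w.

Lemma transp_bilinear :
  bilinear_for (GRing.Scale.Law.clone _ _ *:%R _)
    (GRing.Scale.Law.clone _ _ *:%R _) transp_val.
Proof.
by split=> [v|w] k x y /=; rewrite /transp_val ?linearPr ?linearPl.
Qed.
HB.instance Definition _ :=
  bilinear_isBilinear.Build R W V R _ _ transp_val transp_bilinear.

Lemma transp_continuous : continuous (fun z : W * V => transp_val z.1 z.2).
Proof.
move=> z.
apply: (@continuous_comp _ _ _ (fun z => (z.2, z.1)) (fun z => b z.1 z.2)).
  by apply: cvg_pair => /=; [exact: cvg_snd|exact: cvg_fst].
exact: cbil_continuous.
Qed.

Definition transp : cbilinear W V := CBilinear transp_continuous.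
End Operators.

(* The transpose B^* : Q -> V', with <B^* q, v> = b(v, q). *)
Definition opBt {R : realType} {V W : normedModType R} (b : cbilinear V W) :
  W -> topdual V := opB (transp b).

Record csubspace (R : realType) (V : normedModType R) := CSubspace {
  cs_set : set V;
  cs0 : cs_set 0;
  csP : forall (k : R) x y, cs_set x -> cs_set y -> cs_set (k *: x + y);
  cs_closed : closed cs_set
}.

Section Kernel.
Context {R : realType} {V W : normedModType R}.
Variable b : cbilinear V W.

Lemma opB_linear : linear (opB b).
Proof. by move=> k x y; apply: dualP => w /=; rewrite linearPl. Qed.

Definition ker_set : set V := [set v | opB b v = 0].

Lemma ker_setE : ker_set = \bigcap_(w in setT) [set v | b v w = 0].
Proof.
apply/seteqP; split=> v /=; first by move=> h w _; have /= := congr1 (fun phi : topdual W => phi w) h.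
by move=> h; apply: dualP => w; exact: h.
Qed.

Lemma ker0 : ker_set 0.
Proof. by apply: dualP => w /=; rewrite linear0l. Qed.

Lemma kerP (k : R) x y : ker_set x -> ker_set y -> ker_set (k *: x + y).
Proof. by rewrite /ker_set/= opB_linear => -> ->; rewrite scaler0 addr0. Qed.

Lemma ker_closed : closed ker_set.
Proof.
rewrite ker_setE; apply: closed_bigI => w _.
apply: (@preimage_closed _ _ (fun v => b v w) [set 0]).
  by move=> v _; exact: (@dual_continuous _ _ (opBt b w)).
exact: closed_eq.
Qed.

Definition kerB : csubspace V := CSubspace ker0 kerP ker_closed.
End Kernel.

Definition kerBt {R : realType} {V W : normedModType R} (b : cbilinear V W) :
  csubspace W := kerB (transp b).

Section HilbertTheory.
Context {R : realType} {V : hilbertType R}.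
Implicit Types x y z : V.

Lemma innerPr (k : R) x y z : inner z (k *: x + y) = k * inner z x + inner z y.
Proof. by rewrite innerC innerPl !(innerC _ z). Qed.
Lemma inner0l x : inner 0 x = 0.
Proof. by have := innerPl (-1) x x x; rewrite scaleN1r addNr mulN1r addNr. Qed.
Lemma inner0r x : inner x 0 = 0.
Proof. by rewrite innerC inner0l. Qed.
Lemma innerDl x y z : inner (x + y) z = inner x z + inner y z.
Proof. by rewrite -{1}[x]scale1r innerPl mul1r. Qed.
Lemma innerZl (k : R) x z : inner (k *: x) z = k * inner x z.
Proof. by rewrite -{1}[k *: x]addr0 innerPl inner0l addr0. Qed.
Lemma innerNl x z : inner (- x) z = - inner x z.
Proof. by rewrite -scaleN1r innerZl mulN1r. Qed.
Lemma innerBl x y z : inner (x - y) z = inner x z - inner y z.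
Proof. by rewrite innerDl innerNl. Qed.
Lemma innerDr x y z : inner x (y + z) = inner x y + inner x z.
Proof. by rewrite innerC innerDl !(innerC _ x). Qed.
Lemma innerZr (k : R) x z : inner z (k *: x) = k * inner z x.
Proof. by rewrite innerC innerZl innerC. Qed.
Lemma innerNr x z : inner x (- z) = - inner x z.
Proof. by rewrite innerC innerNl innerC. Qed.
Lemma innerBr x y z : inner z (x - y) = inner z x - inner z y.
Proof. by rewrite innerDr innerNr. Qed.

Lemma normD2 x y : `|x + y| ^+ 2 = `|x| ^+ 2 + 2 * inner x y + `|y| ^+ 2.
Proof. by rewrite -!inner_normE innerDl !innerDr (innerC y x); ring. Qed.

Lemma parallelogram x y :
  `|x + y| ^+ 2 + `|x - y| ^+ 2 = 2 * `|x| ^+ 2 + 2 * `|y| ^+ 2.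
Proof. by rewrite !normD2 normrN innerNr; ring. Qed.

Lemma pythagoras x y : inner x y = 0 -> `|x + y| ^+ 2 = `|x| ^+ 2 + `|y| ^+ 2.
Proof. by move=> h; rewrite normD2 h mulr0 addr0. Qed.

Lemma cauchy_schwarz x y : `|inner x y| <= `|x| * `|y|.
Proof.
have [->|y0] := eqVneq y 0; first by rewrite inner0r !normr0 mulr0.
have ny : 0 < `|y| ^+ 2 by rewrite exprn_gt0// normr_gt0.
rewrite -ler_sqr ?nnegrE ?mulr_ge0// exprMn real_normK ?num_real//.
have := sqr_ge0 `|x - (inner x y / `|y| ^+ 2) *: y|.
rewrite -inner_normE innerBl !innerBr !innerZl !innerZr !inner_normE (innerC y x).
set i := inner x y; set n := `|y| ^+ 2.
have -> : `|x| ^+ 2 - i / n * i - (i / n * i - i / n * (i / n * n)) =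
  `|x| ^+ 2 - i ^+ 2 / n by field; rewrite gt_eqF.
by rewrite subr_ge0 ler_pdivrMr.
Qed.

Lemma inner_continuous x : continuous (inner x : V -> R).
Proof.
move=> y; apply/cvgrPdist_le => e e0.
have p : 0 < e / (`|x| + 1) by rewrite divr_gt0// ltr_wpDl.
near=> z; rewrite -innerBr; apply: le_trans (cauchy_schwarz _ _) _.
have h : `|y - z| <= e / (`|x| + 1).
  by near: z; exact: cvgr_dist_le.
apply: (@le_trans _ _ ((`|x| + 1) * (e / (`|x| + 1)))).
  by rewrite ler_pM// lerDl.
by rewrite mulrC divfK// gt_eqF// ltr_wpDl.
Unshelve. all: by end_near. Qed.
End HilbertTheory.

Section Projection.
Context {R : realType} {V : hilbertType R}.
Variable K : csubspace V.

Lemma csD x y : cs_set K x -> cs_set K y -> cs_set K (x + y).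
Proof. by move=> *; rewrite -[x]scale1r; exact: csP. Qed.
Lemma csZ (k : R) x : cs_set K x -> cs_set K (k *: x).
Proof. by move=> *; rewrite -[_ *: _]addr0; apply: csP => //; exact: cs0. Qed.
Lemma csB x y : cs_set K x -> cs_set K y -> cs_set K (x - y).
Proof. by move=> *; rewrite addrC -scaleN1r; exact: csP. Qed.

Definition orth_set : set V := [set v | forall w, cs_set K w -> inner v w = 0].

Lemma orth_set0 : orth_set 0.
Proof. by move=> w _; rewrite inner0l. Qed.

Lemma orth_setP (k : R) x y :
  orth_set x -> orth_set y -> orth_set (k *: x + y).
Proof. by move=> hx hy w Kw; rewrite innerPl hx// hy// mulr0 addr0. Qed.

Lemma orth_set_closed : closed orth_set.
Proof.
have -> : orth_set = \bigcap_(w in cs_set K) [set v | inner w v = 0].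
  by apply/seteqP; split=> v h w Kw /=; [rewrite innerC h|rewrite innerC; exact: h].
apply: closed_bigI => w _.
apply: (@preimage_closed _ _ (inner w) [set 0]).
  by move=> v _; exact: inner_continuous.
exact: closed_eq.
Qed.

Definition orthc : csubspace V := CSubspace orth_set0 orth_setP orth_set_closed.

Definition is_proj (x k : V) := cs_set K k /\ cs_set orthc (x - k).

Let D (x : V) := [set `|x - k| | k in cs_set K].
Let d x := inf (D x).

Let d_lb x k : cs_set K k -> d x <= `|x - k|.
Proof.
move=> Kk; apply: ge_inf; last by exists k.
by exists 0 => _ [? _ <-].
Qed.

Let d_ge0 x : 0 <= d x.
Proof.
apply: lb_le_inf; first by exists `|x - 0|, 0 => //; exact: cs0.
by move=> _ [? _ <-].
Qed.

Let minseq x :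
  exists k : nat -> V, forall n, cs_set K (k n) /\ `|x - k n| < d x + n.+1%:R^-1.
Proof.
suff /choice[k hk] : forall n, exists k, cs_set K k /\ `|x - k| < d x + n.+1%:R^-1
  by exists k.
move=> n.
have : has_inf (D x).
  split; first by exists `|x - 0|, 0 => //; exact: cs0.
  by exists 0 => _ [? _ <-].
move=> hD; have := @inf_adherent _ _ n.+1%:R^-1 _ hD.
rewrite invr_gt0 ltr0n => /(_ isT)[_ [k Kk <-] h].
by exists k.
Qed.

Lemma proj_ex x : exists k, is_proj x k.
Proof.
have [k hk] := minseq x.
have mid m n : `|k m - k n| ^+ 2 <=
    2 * `|x - k m| ^+ 2 + 2 * `|x - k n| ^+ 2 - 4 * d x ^+ 2.
  have := parallelogram (x - k n) (x - k m).
  rewrite (_ : x - k n - (x - k m) = k m - k n); last first.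
    by rewrite opprB addrC addrA subrK.
  have Km : cs_set K (2^-1 *: (k m + k n)).
    by apply: csZ; apply: csD; [have [] := hk m|have [] := hk n].
  have -> : x - k n + (x - k m) = 2 *: (x - 2^-1 *: (k m + k n)).
    rewrite scalerBr scalerA divff// scale1r scaler_nat mulr2n.
    by rewrite [LHS]addrACA opprD (addrC (- k n)).
  rewrite normrZ exprMn => h.
  have dle : d x ^+ 2 <= `|x - 2^-1 *: (k m + k n)| ^+ 2.
    by rewrite ler_sqr ?nnegrE ?d_ge0// d_lb.
  have e4 : `|2%:R : R| ^+ 2 = 4 by rewrite ger0_norm// -natrX.
  by rewrite e4 in h; lra.
have cvk : cvg (k @ \oo).
  apply: cauchy_cvg; apply: cauchy_exP => e e0.
  have d1 : 0 < 2 * d x + 1 by have := d_ge0 x; lra.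
  have p : 0 < e ^+ 2 / (4 * (2 * d x + 1)).
    by rewrite divr_gt0 ?exprn_gt0// mulr_gt0.
  have [N _ hN] := near_infty_natSinv_lt (PosNum p).
  exists (k N); exists N => // n /= Nn; rewrite -ball_normE /=.
  rewrite -ltr_sqr ?nnegrE ?normr_ge0 ?(ltW e0)//.
  apply: le_lt_trans (mid N n) _.
  have hN' := hN N (leqnn N); rewrite /= in hN'.
  have bnd j : (N <= j)%N -> `|x - k j| ^+ 2 <= d x ^+ 2 +
     (N.+1%:R^-1 * (2 * d x + 1)).
    move=> Nj; have [_ hj] := hk j.
    have jN : j.+1%:R^-1 <= N.+1%:R^-1 :> R by rewrite lef_pV2 ?posrE// ler_nat.
    have N1 : N.+1%:R^-1 <= 1 :> R by rewrite invf_le1// ler1n.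
    have N0 : 0 <= N.+1%:R^-1 :> R by rewrite invr_ge0.
    apply: (@le_trans _ _ ((d x + N.+1%:R^-1) ^+ 2)).
      rewrite ler_sqr ?nnegrE ?addr_ge0 ?d_ge0//.
      by apply: (le_trans (ltW hj)); rewrite lerD2l.
    move: N1 N0 (d_ge0 x); set r := N.+1%:R^-1 => N1 N0 dx0.
    have : r * r <= r by rewrite ler_piMr.
    by nra.
  have h1 := bnd N (leqnn N); have h2 := bnd n Nn.
  move: hN'; rewrite ltr_pdivlMr ?mulr_gt0//.
  by move: h1 h2; set r := N.+1%:R^-1 => h1 h2 hN'; lra.
pose l := lim (k @ \oo); exists l.
have Kl : cs_set K l.
  apply: (closed_cvg _ (@cs_closed _ _ K) _ _ cvk).
  by near=> n; have [] := hk n.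
have xl : `|x - l| = d x.
  apply/eqP; rewrite eq_le (d_lb x Kl) andbT.
  apply/ler_addgt0Pr => e e0.
  have cn : `|x - k n| @[n --> \oo] --> `|x - l|.
    by apply: cvg_norm; apply: cvgB => //; exact: cvg_cst.
  rewrite -(cvg_lim _ cn)//; apply: limr_le; first by apply/cvg_ex; exists `|x - l|.
  near=> n; have [_ /ltW/le_trans->//] := hk n.
  rewrite lerD2l; apply/ltW; near: n; exact: (near_infty_natSinv_lt (PosNum e0)).
split=> // w Kw.
have [->|w0] := eqVneq w 0; first by rewrite inner0r.
have nw : 0 < `|w| ^+ 2 by rewrite exprn_gt0// normr_gt0.
pose t := inner (x - l) w / `|w| ^+ 2.
have h : d x ^+ 2 <= `|x - (t *: w + l)| ^+ 2.
  by rewrite ler_sqr ?nnegrE ?d_ge0// d_lb//; exact: csP.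
have xt : x - (t *: w + l) = (x - l) - t *: w by rewrite opprD addrA addrAC.
have := h; rewrite -xl xt [X in _ <= X]normD2 normrN normrZ innerNr innerZr.
rewrite exprMn (real_normK (num_real t)) => h'.
have : inner (x - l) w ^+ 2 / `|w| ^+ 2 <= 0.
  have e1 : t * inner (x - l) w = inner (x - l) w ^+ 2 / `|w| ^+ 2.
    by rewrite /t expr2 mulrAC.
  have e2 : t ^+ 2 * `|w| ^+ 2 = inner (x - l) w ^+ 2 / `|w| ^+ 2.
    by rewrite /t; field; rewrite normr_eq0 w0.
  by move: h'; rewrite e2 -e1; lra.
rewrite pmulr_lle0 ?invr_gt0// => h2.
by apply/eqP; rewrite -sqrf_eq0 eq_le h2 sqr_ge0.
Unshelve. all: by end_near. Qed.

Lemma proj_uniq x k k' : is_proj x k -> is_proj x k' -> k = k'.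
Proof.
move=> [Kk ok] [Kk' ok']; apply/eqP; rewrite -subr_eq0 -normr_eq0 -sqrf_eq0.
rewrite -inner_normE; have Kd := csB Kk Kk'.
rewrite {1}(_ : k - k' = (x - k') - (x - k)); last first.
  by rewrite opprB [RHS]addrC addrA subrK.
by rewrite innerBl ok// ok'// subrr.
Qed.

(* By [proj_ex] and [proj_uniq] the default value 0 is never used. *)
Definition orth_proj (x : V) : V := xget 0 [set k | is_proj x k].

Lemma projP x : is_proj x (orth_proj x).
Proof. by have [k] := proj_ex x; exact: (@xgetI _ 0 (fun k => is_proj x k)). Qed.

Lemma proj_in x : cs_set K (orth_proj x).
Proof. by have [] := projP x. Qed.

Lemma sub_proj_in x : cs_set orthc (x - orth_proj x).
Proof. by have [] := projP x. Qed.

Lemma proj_linear : linear orth_proj.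
Proof.
move=> k x y; apply: (@proj_uniq (k *: x + y)); first exact: projP.
split; first by apply: csP; exact: proj_in.
rewrite (_ : _ - _ = k *: (x - orth_proj x) + (y - orth_proj y)).
  by apply: csP; exact: sub_proj_in.
by rewrite scalerBr opprD addrACA.
Qed.

HB.instance Definition _ := GRing.isLinear.Build R V V _ orth_proj proj_linear.

Lemma proj_norm x : `|orth_proj x| <= `|x|.
Proof.
rewrite -ler_sqr ?nnegrE// -{2}(subrK (orth_proj x) x) pythagoras ?lerDr//.
by have [_] := projP x; apply; exact: proj_in.
Qed.

Lemma proj_continuous : continuous orth_proj.
Proof.
apply: bounded_linear_continuous; apply/linear_boundedP.
near=> r => x; apply: le_trans (proj_norm x) _.
by rewrite ler_peMl//; near: r; exact: nbhs_pinfty_ge.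
Unshelve. all: by end_near. Qed.
End Projection.

Lemma proj_orthc (R : realType) (V : hilbertType R) (K : csubspace V) (x : V) :
  x = orth_proj K x + orth_proj (orthc K) x.
Proof.
apply/eqP; rewrite addrC -subr_eq; apply/eqP.
apply: (@proj_uniq _ _ (orthc K) x); last exact: projP.
split; first exact: sub_proj_in.
rewrite opprB addrC subrK => w Kw.
by rewrite innerC; apply: Kw; exact: proj_in.
Qed.

(* With phi = f(t), [dual_part K phi] is f_0(t) and [dual_part (orthc K) phi] is
   the component of f(t) acting on the orthogonal complement of K. *)
Section DualPart.
Context {R : realType} {V : hilbertType R}.
Variables (K : csubspace V) (phi : topdual V).

Lemma dual_part_subproof : (fun v => phi (orth_proj K v)) \in dual_pred V.
Proof.
apply/dual_predE; split=> [k x y|x]; first by rewrite !linearP.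
by apply: continuous_comp; [exact: proj_continuous|exact: dual_continuous].
Qed.

Definition dual_part : topdual V := Dual dual_part_subproof.
End DualPart.

(* The Bochner space L^1([0,T]; B). Functions are represented by maps [R -> B]
   of which only the values on [0,T] matter, up to a.e. equality. The library's
   Lebesgue measure lives on the (non complete) Borel sigma-algebra, so a
   strongly measurable function, an a.e. limit of simple functions, need not be
   Borel measurable; its norm and the scalar functions built from it are a.e.
   equal to Borel functions. The library's integral is total, and since it is
   defined through suprema over simple functions it is insensitive to changes
   on null sets even without Borel measurability. *)
Section Bochner.
Context {R : realType} {B : normedModType R}.
Local Notation mu := (@lebesgue_measure R).

Definition simple_function (s : R -> B) :=
  finite_set (range s) /\ forall x, measurable (s @^-1` [set x]).

Definition strongly_measurable (T : R) (f : R -> B) :=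
  exists s : nat -> R -> B, (forall n, simple_function (s n)) /\
    {ae mu, forall t, 0 <= t <= T -> s n t @[n --> \oo] --> f t}.

Definition L1norm (T : R) (f : R -> B) : \bar R :=
  (\int[mu]_(t in `[0%R, T]) `|f t|%:E)%E.

Definition inL1 (T : R) (f : R -> B) :=
  strongly_measurable T f /\ (L1norm T f < +oo)%E.
End Bochner.

Section Volterra.
Context {R : realType} {V Q : hilbertType R}.
Local Notation mu := (@lebesgue_measure R).

Definition triangle (T : R) : set (R * R) :=
  [set z | 0 <= z.2 /\ z.2 <= z.1 /\ z.1 <= T].

Definition volterra_kernel (T Ck : R) (k : R -> R -> R) :=
  {within triangle T, continuous (fun z : R * R => k z.1 z.2)} /\
  forall z, triangle T z -> `|k z.1 z.2| <= Ck.

Definition volterra_solution (T : R) (a : cbilinear V V) (b : cbilinear V Q)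
    (c : cbilinear Q Q) (k1 k2 k3 k4 : R -> R -> R)
    (f : R -> topdual V) (g : R -> topdual Q) (u : R -> V) (p : R -> Q) :=
  inL1 T (fun t => (u t, p t)) /\
  {ae mu, forall t, 0 <= t <= T -> forall (v : V) (q : Q),
     a (u t) v + b v (p t) = f t v
       + \int[mu]_(s in `[0, t]) (k1 t s * a (u s) v + k2 t s * b v (p s)) /\
     b (u t) q - c (p t) q = g t q
       + \int[mu]_(s in `[0, t]) (k3 t s * b (u s) q - k4 t s * c (p s) q)}.
End Volterra.

(* Main.v *)
Require Import Defs.
From HB Require Import structures.
From mathcomp Require Import all_boot all_order all_algebra.
From mathcomp Require Import ring lra.
From mathcomp Require Import all_classical all_reals all_analysis.
From mathcomp Require Import measurable_realfun.

(** The static saddle point operator A on the Hilbert space V x Q is symmetric;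
    the energy identity, Cauchy-Schwarz for the semi-definite forms and the two
    inf-sup conditions give |x| <= Cs |A x|, hence a bounded inverse S. Applying S
    turns the system into a second-kind Volterra equation
      x(t) = S(f(t), g(t)) + int_0^t G(t, s) x(s) ds,
    whose bounded kernel G does not involve |b|, because S maps the part of the
    integrand that contains b to (u, 0) and (0, p) up to terms in a and c. Picard
    iteration in the norm weighted by exp(2 M t) solves it, and Gronwall's lemma in
    L^1, proved on steps of length T / N with M T / N <= 1 / 2, bounds every solution;
    uniqueness follows, and all the constants C_i can be taken equal to C. The
    integrals of vector-valued functions are weak ones, given by Riesz's theorem. *)

Set Implicit Arguments.
Unset Strict Implicit.
Unset Printing Implicit Defensive.

Import Order.TTheory GRing.Theory Num.Theory.
Import numFieldNormedType.Exports.

Local Open Scope classical_set_scope.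
Local Open Scope ring_scope.

(** * Riesz representation in a real Hilbert space *)

Section RieszRepresentation.
Context {R : realType} {V : hilbertType R}.

(** The function C is chosen before the spaces and the forms, so |b| may enter neither the bound of
    the inverse nor that of the Volterra kernel. It does enter the bound on A behind the fixed-point
    argument for surjectivity, but leaves no trace in the estimate of S. As [a] and [c] are coercive
    on the kernels only, the energy controls a(u, u) + c(p, p) but not |u| + |p|. The static
    estimate therefore carries a square root of |u| + |p|, which Young's inequality absorbs. On the
    analytic side, strongly measurable functions need not be Borel, so data and solutions are first
    replaced by a.e. equal functions that are limits of simple functions at every point.
    Measurability in t of the Picard corrections comes from their continuity, and Gronwall's lemma
    replaces the inner integral by one constant on each short step. *)

Lemma inner_inj (x y : V) : (forall z, inner x z = inner y z) -> x = y.
Proof.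
move=> h; apply/eqP; rewrite -subr_eq0 -normr_eq0 -sqrf_eq0 -inner_normE.
by rewrite innerBl h subrr.
Qed.

Lemma norm_le_inner (x : V) (M : R) :
  0 <= M -> (forall y, inner x y <= M * `|y|) -> `|x| <= M.
Proof.
move=> M0 h; have [->|x0] := eqVneq x 0; first by rewrite normr0.
have := h x; by rewrite inner_normE expr2 ler_pM2r// normr_gt0.
Qed.

Lemma riesz_ex (phi : topdual V) : exists x : V, forall y, inner x y = phi y.
Proof.
have K0 : [set v | phi v = 0] 0 by exact: linear0.
have KP (k : R) x y : [set v | phi v = 0] x -> [set v | phi v = 0] y ->
    [set v | phi v = 0] (k *: x + y).
  by move=> /= hx hy; rewrite dual_linear hx hy scaler0 addr0.
have Kc : closed [set v | phi v = 0].
  apply: (@preimage_closed _ _ (phi : V -> R) [set 0]).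
    by move=> v _; exact: dual_continuous.
  exact: closed_eq.
pose K := CSubspace K0 KP Kc.
have [[z z0]|h] := pselect (exists z, phi z != 0); last first.
  exists 0 => y; rewrite inner0l; apply/esym/eqP/negP => /negP py.
  by apply: h; exists y.
pose w := z - orth_proj K z.
have pw : phi w = phi z by rewrite linearB/= (@proj_in _ _ K z) subr0.
have w0 : `|w| ^+ 2 != 0.
  rewrite sqrf_eq0 normr_eq0; apply: contra_neq z0 => w0.
  by rewrite -pw w0 linear0.
exists ((phi w / `|w| ^+ 2) *: w) => y; rewrite innerZl.
have wK v : phi v = 0 -> inner w v = 0.
  exact: (@sub_proj_in _ _ K z v).
(* Subtracting from [y] the multiple of [w] with the same value of [phi] lands in the kernel of
   [phi], to which [w] is orthogonal. *)
have : inner w (- (phi y / phi w) *: w + y) = 0.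
  apply: wK; rewrite dual_linear scaleNr.
  by rewrite /GRing.scale/= divfK ?pw// addNr.
rewrite innerPr inner_normE mulNr => /eqP; rewrite addrC subr_eq0 => /eqP ->.
field; apply/andP; split; [by move: z0; rewrite -pw|by rewrite -sqrf_eq0].
Qed.

Definition riesz (phi : topdual V) : V := sval (cid (riesz_ex phi)).

Lemma rieszE phi y : inner (riesz phi) y = phi y.
Proof. by rewrite /riesz; case: cid. Qed.

Lemma riesz_linear : linear riesz.
Proof.
by move=> k x y; apply: inner_inj => z; rewrite innerPl !rieszE.
Qed.

HB.instance Definition _ := GRing.isLinear.Build R (topdual V) V _ riesz riesz_linear.

Lemma riesz_norm phi : `|riesz phi| <= `|phi|.
Proof.
apply: norm_le_inner => // y; rewrite rieszE.
by apply: le_trans (ler_norm _) _; exact: dual_norm_ub.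
Qed.
End RieszRepresentation.

(** * Symmetric operators that are bounded below are onto *)

Lemma linear_norm_le_continuous (R : realType) (V W : normedModType R)
    (L : {linear V -> W}) (M : R) :
  (forall x, `|L x| <= M * `|x|) -> continuous L.
Proof.
move=> LM; apply: bounded_linear_continuous; apply/linear_boundedP.
by exists M; split=> [|r /ltW Mr x]; rewrite ?num_real// (le_trans (LM x))// ler_wpM2r.
Qed.

(* The map [x |-> x - N^-2 A (A x - z)] is a contraction: for some [k > 0],
   [x - N^-2 A (A x)] has norm at most [sqrt (1 - k) * `|x|]. *)
Lemma symmetric_bounded_below_surj (R : realType) (X : hilbertType R)
    (A : {linear X -> X}) (N C : R) :
  0 < N -> 0 < C -> (forall x, `|A x| <= N * `|x|) ->
  (forall x, `|x| <= C * `|A x|) ->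
  (forall x y, inner (A x) y = inner x (A y)) ->
  forall z, exists x, A x = z.
Proof.
move=> N0 C0 AN AC Asym z.
(* The spectrum of N^-2 A^2 lies between 1 / (N C)^2 and 1. The number [k] is below it, and the
   added 1 keeps [k] at most 1, so that sqrt (1 - k) is a contraction constant. *)
pose k : R := (1 + N ^+ 2 * C ^+ 2)^-1.
have NC : 0 <= N ^+ 2 * C ^+ 2 by rewrite mulr_ge0 ?sqr_ge0.
have k0 : 0 < k by rewrite invr_gt0 ltr_wpDr.
have k1 : k <= 1 by rewrite invf_le1 ?lerDl// ltr_wpDr.
pose f (x : X) := x - (N ^- 2) *: A (A x - z).
pose F : {fun [set: X] >-> [set: X]} := 'totalfun_setT f.
have [] := @banach_fixed_point R X setT F.
- exists (NngNum (sqrtr_ge0 (1 - k))); split => /=.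
    by rewrite -[ltRHS]sqrtr1 ltr_sqrt// gtrBl.
  move=> [x y] _ /=; rewrite /F /totalfun/=.
  have -> : f x - f y = (x - y) - (N ^- 2) *: A (A (x - y)).
    have -> : A (A (x - y)) = A (A x - z) - A (A y - z).
      by rewrite -linearB; congr (A _); rewrite linearB opprB addrA subrK.
    by rewrite /f scalerBr !opprB -!addrA; congr (_ + _); rewrite [LHS]addrC [LHS]addrAC [LHS]addrC.
  move: (x - y) => {x y} h.
  rewrite -[leLHS]ger0_norm// -[leRHS]ger0_norm ?mulr_ge0//.
  rewrite -ler_sqr ?nnegrE// !real_normK ?num_real// exprMn sqr_sqrtr ?subr_ge0//.
  have N20 : 0 < N ^- 2 by rewrite invr_gt0 exprn_gt0.
  (* By symmetry the cross term is -2 N^-2 |A h|^2. The square term is at most N^-2 |A h|^2, so a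
     net -N^-2 |A h|^2 remains, and the lower bound turns it into -k |h|^2. *)
  rewrite normD2 innerNr innerZr -Asym inner_normE normrN normrZ exprMn.
  rewrite (ger0_norm (ltW N20)).
  have h1 : `|A (A h)| ^+ 2 <= N ^+ 2 * `|A h| ^+ 2.
    by rewrite -exprMn ler_sqr ?nnegrE// mulr_ge0// ltW.
  have h2 : `|h| ^+ 2 <= C ^+ 2 * `|A h| ^+ 2.
    by rewrite -exprMn ler_sqr ?nnegrE// mulr_ge0// ltW.
  have h3 : N ^- 2 ^+ 2 * `|A (A h)| ^+ 2 <= N ^- 2 * `|A h| ^+ 2.
    apply: le_trans (ler_wpM2l _ h1) _; first by rewrite sqr_ge0.
    by rewrite mulrA [X in X * _](_ : _ = N ^- 2)//; field; rewrite gt_eqF.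
  have h4 : k * `|h| ^+ 2 <= N ^- 2 * `|A h| ^+ 2.
    rewrite -ler_pdivlMl// /k invrK;
      apply: (@le_trans _ _ (N ^+ 2 * C ^+ 2 * (N ^- 2 * `|A h| ^+ 2))).
      by rewrite mulrACA divff ?mul1r// ?gt_eqF ?exprn_gt0.
    by rewrite ler_wpM2r ?mulr_ge0 ?sqr_ge0 ?lerDr// ltW.
  by lra.
- exact: closedT.
- by exists 0.
(* A fixed point satisfies A (A x - z) = 0, and the lower bound makes [A] injective. *)
move=> x _ /=; rewrite /F /totalfun/= /f => /eqP.
rewrite -subr_eq0 opprB addrC subrK scaler_eq0 invr_eq0.
rewrite (gt_eqF (exprn_gt0 _ N0))/= => /eqP Ax0; exists x; apply/eqP.
rewrite -subr_eq0 -normr_le0.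
by apply: le_trans (AC _) _; rewrite Ax0 normr0 mulr0.
Qed.
(* [V * Q] with the Euclidean norm, the library's product norm being the maximum. *)
Definition hprod (R : realType) (V Q : hilbertType R) : Type := (V * Q)%type.

(** * The product of two Hilbert spaces as a Hilbert space *)

Section HilbertProduct.
Context {R : realType} {V Q : hilbertType R}.
Local Notation X := (hprod V Q).

HB.instance Definition _ := GRing.Lmodule.copy X (V * Q)%type.

Definition hprod_inner (x y : X) : R := inner x.1 y.1 + inner x.2 y.2.
Definition hprod_norm (x : X) : R := Num.sqrt (`|x.1| ^+ 2 + `|x.2| ^+ 2).

Let norm2 (x : X) : hprod_norm x ^+ 2 = `|x.1| ^+ 2 + `|x.2| ^+ 2.
Proof. by rewrite sqr_sqrtr// addr_ge0 ?sqr_ge0. Qed.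

Let norm_ge0 (x : X) : 0 <= hprod_norm x.
Proof. exact: sqrtr_ge0. Qed.

Let normD (x y : X) : hprod_norm (x + y) <= hprod_norm x + hprod_norm y.
Proof.
rewrite -ler_sqr ?nnegrE ?addr_ge0// sqrrD !norm2 /=.
have D1 := ler_normD x.1 y.1; have D2 := ler_normD x.2 y.2.
have CS : `|x.1| * `|y.1| + `|x.2| * `|y.2| <= hprod_norm x * hprod_norm y.
  rewrite -ler_sqr ?nnegrE ?addr_ge0 ?mulr_ge0// [leRHS]exprMn !norm2.
  have := sqr_ge0 (`|x.1| * `|y.2| - `|x.2| * `|y.1|); rewrite -subr_ge0.
  by set D := (D in _ -> D); move=> h; rewrite /D -subr_ge0 -[leRHS]subr0; nra.
have S1 : `|x.1 + y.1| ^+ 2 <= (`|x.1| + `|y.1|) ^+ 2.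
  by rewrite ler_sqr ?nnegrE ?addr_ge0.
have S2 : `|x.2 + y.2| ^+ 2 <= (`|x.2| + `|y.2|) ^+ 2.
  by rewrite ler_sqr ?nnegrE ?addr_ge0.
by apply: le_trans (lerD S1 S2) _; lra.
Qed.

Let normZ (k : R) (x : X) : hprod_norm (k *: x) = `|k| * hprod_norm x.
Proof.
rewrite /hprod_norm /= !normrZ !exprMn -mulrDr sqrtrM ?sqr_ge0//.
by rewrite sqrtr_sqr normr_id.
Qed.

Let norm0_eq0 (x : X) : hprod_norm x = 0 -> x = 0.
Proof.
move=> h; have := norm2 x; rewrite h expr0n/= => /esym/eqP.
rewrite paddr_eq0 ?sqr_ge0// !sqrf_eq0 !normr_eq0.
by case: x {h} => u p /= /andP[/eqP -> /eqP ->].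
Qed.

HB.instance Definition _ :=
  Lmodule_isNormed.Build R X normD normZ norm0_eq0.

Lemma hprod_normE (x : X) : `|x| ^+ 2 = `|x.1| ^+ 2 + `|x.2| ^+ 2.
Proof. exact: norm2. Qed.

Lemma hprod_norm1 (x : X) : `|x.1| <= `|x|.
Proof. by rewrite -ler_sqr ?nnegrE// hprod_normE lerDl sqr_ge0. Qed.

Lemma hprod_norm2 (x : X) : `|x.2| <= `|x|.
Proof. by rewrite -ler_sqr ?nnegrE// hprod_normE lerDr sqr_ge0. Qed.

Lemma hprod_norm_le (x : X) : `|x| <= `|x.1| + `|x.2|.
Proof.
rewrite -ler_sqr ?nnegrE ?addr_ge0// hprod_normE sqrrD.
by rewrite -addrA lerD2l lerDr mulrn_wge0 ?mulr_ge0.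
Qed.

(** Both projections are 1-Lipschitz for the Euclidean norm, so a Cauchy filter has a limit in each
    component, and the sum of the component norms dominates the Euclidean one. *)
Lemma hprod_complete (F : set_system X) : ProperFilter F -> cauchy F -> cvg F.
Proof.
move=> FF Fc.
have part (W : completeNormedModType R) (pr : X -> W) :
    (forall x y, `|pr x - pr y| <= `|x - y|) -> cvg (pr @ F).
  move=> prl; apply: cauchy_cvg; apply: cauchy_exP => e e0.
  have [x Fx] := (cauchyP _).1 Fc e e0; exists (pr x).
  have FB : F (pr @^-1` ball (pr x) e).
    apply: filterS Fx => y; rewrite -!ball_normE /=; exact/le_lt_trans/prl.
  exact: FB.
have /cvg_ex[u Fu] := part V fst (fun x y => hprod_norm1 (x - y)).
have /cvg_ex[p Fp] := part Q snd (fun x y => hprod_norm2 (x - y)).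
apply/cvg_ex; exists ((u, p) : X); apply/cvgrPdist_lt => e e0.
have e2 : 0 < e / 2 by rewrite divr_gt0.
move/cvgrPdist_lt: Fu => /(_ _ e2) Fu; move/cvgrPdist_lt: Fp => /(_ _ e2) Fp.
near=> x; apply: le_lt_trans (hprod_norm_le _) _ => /=.
by rewrite (splitr e) ltrD//; near: x.
Unshelve. all: by end_near. Qed.

HB.instance Definition _ := Uniform_isComplete.Build X hprod_complete.

Let ipC (x y : X) : hprod_inner x y = hprod_inner y x.
Proof. by rewrite /hprod_inner innerC (innerC x.2). Qed.

Let ipP (k : R) (x y z : X) :
  hprod_inner (k *: x + y) z = k * hprod_inner x z + hprod_inner y z.
Proof. by rewrite /hprod_inner /= !innerPl mulrDr addrACA. Qed.

Let ipE (x : X) : hprod_inner x x = `|x| ^+ 2.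
Proof. by rewrite /hprod_inner !inner_normE hprod_normE. Qed.

HB.instance Definition _ :=
  CompleteNormedModule_isHilbert.Build R X ipC ipP ipE.

Lemma hprod_innerE (x y : X) : inner x y = inner x.1 y.1 + inner x.2 y.2.
Proof. by []. Qed.
End HilbertProduct.

(** * Norms of bilinear forms, semi-definite forms, inf-sup quotients *)

Section BilinearForms.
Context {R : realType}.

(** Without an upper bound the supremum in [bilinear_norm] would be the default 0. Continuity at the
    origin gives |a| <= 1 on a ball of radius d, into which unit vectors are scaled by d / 2. *)
Lemma bilinear_norm_has_sup (V W : normedModType R) (a : cbilinear V W) :
  has_sup [set `|a z.1 z.2| | z in [set z : V * W | `|z.1| <= 1 /\ `|z.2| <= 1]].
Proof.
split; first by exists `|a 0 0|, (0, 0); rewrite //= !normr0.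
have /cvgrPdist_le/(_ 1 ltr01) := @cbil_continuous _ _ _ a (0, 0).
rewrite /= linear0l => /nbhs_normP[d /= d0 hd].
have d20 : 0 < d / 2 by rewrite divr_gt0.
exists ((d / 2) ^- 2) => _ [[v w] /= [v1 w1] <-].
have sm (U : normedModType R) (x : U) : `|x| <= 1 -> `|(d / 2) *: x| < d.
  move=> x1; rewrite normrZ gtr0_norm//; apply: (@le_lt_trans _ _ (d / 2)).
    by rewrite ler_piMr// ltW.
  by rewrite ltr_pdivrMr// ltr_pMr// ltr1n.
have := hd ((d / 2) *: v, (d / 2) *: w).
rewrite /= !sub0r !normrN => h; move: h.
rewrite linearZl/= linearZr/= /GRing.scale/= mulrA -expr2 normrM gtr0_norm ?exprn_gt0//.
rewrite -ler_pdivlMl ?exprn_gt0// mulr1; apply.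
rewrite (_ : `|_| = Num.max `|(d / 2) *: v| `|(d / 2) *: w|)//.
by rewrite gt_max !sm.
Qed.

Lemma bilinear_norm_ge0 (V W : normedModType R) (a : cbilinear V W) :
  0 <= bilinear_norm a.
Proof.
apply: (le_trans (normr_ge0 (a 0 0))).
apply: sup_upper_bound; first exact: bilinear_norm_has_sup.
by exists (0, 0); rewrite //= !normr0.
Qed.

Lemma bilinear_norm_ub (V W : normedModType R) (a : cbilinear V W) v w :
  `|a v w| <= bilinear_norm a * `|v| * `|w|.
Proof.
have [->|v0] := eqVneq v 0; first by rewrite linear0l !normr0 mulr0 mul0r.
have [->|w0] := eqVneq w 0; first by rewrite linear0r !normr0 mulr0.
have nv : 0 < `|v| by rewrite normr_gt0.
have nw : 0 < `|w| by rewrite normr_gt0.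
rewrite -ler_pdivrMr// -ler_pdivrMr//; apply: sup_upper_bound.
  exact: bilinear_norm_has_sup.
exists (`|v|^-1 *: v, `|w|^-1 *: w) => /=.
  by rewrite !normrZ !normfV !normr_id !mulVf ?gt_eqF.
rewrite linearZl/= linearZr/= /GRing.scale/= !normrM !normfV !normr_id; ring.
Qed.

Lemma psd_cauchy_schwarz (V : normedModType R) (a : {bilinear V -> V -> R}) u v :
  (forall v w, a v w = a w v) -> (forall v, 0 <= a v v) ->
  a u v ^+ 2 <= a u u * a v v.
Proof.
move=> asym a0.
have q r : 0 <= r ^+ 2 * a u u + 2 * r * a u v + a v v.
  have := a0 (r *: u + v); rewrite linearPl/= !linearPr/= (asym v u).
  by rewrite /GRing.scale/=; set A := a u u; set B := a u v; lra.
have [au0|au0] := eqVneq (a u u) 0.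
  rewrite au0 mul0r; have [->|auv] := eqVneq (a u v) 0; first by rewrite expr0n.
  (* With a(u, u) = 0 the polynomial is affine in [r], and this [r] gives it the value -1. *)
  have := q (- (a v v + 1) / (2 * a u v)); rewrite au0.
  by rewrite (_ : _ + _ + _ = -1); [rewrite ler0N1|field].
have au : 0 < a u u by rewrite lt_neqAle eq_sym au0 a0.
have := q (- a u v / a u u); rewrite -(pmulr_rge0 _ au).
rewrite [X in 0 <= X -> _](_ : _ = a u u * a v v - a u v ^+ 2).
  by rewrite subr_ge0.
by field.
Qed.

Lemma sup_quotient_le (V : normedModType R) (phi : V -> R) (L : R) :
  0 <= L -> (forall v, phi v <= L * `|v|) ->
  sup [set phi v / `|v| | v in [set v | v != 0]] <= L.
Proof.
move=> L0 h; set E := image _ _.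
have [[x Ex]|E0] := pselect (exists x, E x).
  apply: ge_sup; first by exists x.
  by move=> _ [v /= v0 <-]; rewrite ler_pdivrMr ?normr_gt0.
(* In the zero space the set of quotients is empty and its [sup] is 0 by convention; this case rests
   on 0 <= L. *)
suff -> : E = set0 by rewrite sup0.
by apply/seteqP; split=> // x Ex; apply: E0; exists x.
Qed.
End BilinearForms.

(** * The static saddle point problem and its inverse *)

Section SaddlePoint.
Context {R : realType} {V Q : hilbertType R}.
Variables (a : cbilinear V V) (b : cbilinear V Q) (c : cbilinear Q Q).

HB.instance Definition _ (U W : normedModType R) (d : cbilinear U W) :=
  GRing.isLinear.Build R U (topdual W) _ (opB d) (@opB_linear _ _ _ d).

(** Adding the two equations without changing the sign of the second keeps the form symmetric, as
    [symmetric_bounded_below_surj] requires. The price is indefiniteness, so the lower bound cannot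
    come from coercivity alone. *)
Definition saddle_form (x y : hprod V Q) : R :=
  a x.1 y.1 + b y.1 x.2 + (b x.1 y.2 - c x.2 y.2).

Definition saddle_op (x : hprod V Q) : hprod V Q :=
  (riesz (opB a x.1 + opBt b x.2), riesz (opB b x.1 - opB c x.2)).

Lemma saddle_opE x y : inner (saddle_op x) y = saddle_form x y.
Proof. by rewrite hprod_innerE !rieszE. Qed.

Lemma saddle_op_linear : linear saddle_op.
Proof.
move=> k x y; apply: inner_inj => z; rewrite innerPl !saddle_opE /saddle_form /=.
by rewrite !linearPl/= !linearPr/= /GRing.scale/=; ring.
Qed.

HB.instance Definition _ :=
  GRing.isLinear.Build R (hprod V Q) (hprod V Q) _ saddle_op saddle_op_linear.

Lemma saddle_op_bounded :
  exists2 N : R, 0 < N & forall x, `|saddle_op x| <= N * `|x|.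
Proof.
set nb := bilinear_norm b; have nb0 : 0 <= nb by exact: bilinear_norm_ge0.
have na0 : 0 <= bilinear_norm a by exact: bilinear_norm_ge0.
have nc0 : 0 <= bilinear_norm c by exact: bilinear_norm_ge0.
exists (bilinear_norm a + nb + (nb + bilinear_norm c) + 1) => [|x].
  by rewrite ltr_wpDl// !addr_ge0.
have x1 := hprod_norm1 x; have x2 := hprod_norm2 x.
apply: norm_le_inner => [|y]; first by rewrite mulr_ge0 ?addr_ge0.
have y1 := hprod_norm1 y; have y2 := hprod_norm2 y.
have ub (U W : normedModType R) (d : cbilinear U W) u w (r s : R) :
    `|u| <= r -> `|w| <= s -> `|d u w| <= bilinear_norm d * (r * s).
  move=> ur ws; apply: le_trans (bilinear_norm_ub _ _ _) _.
  by rewrite -mulrA ler_wpM2l ?bilinear_norm_ge0// ler_pM.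
rewrite saddle_opE /saddle_form; apply: le_trans (ler_norm _) _.
have xy : 0 <= `|x| * `|y| by rewrite mulr_ge0.
apply: (@le_trans _ _ ((bilinear_norm a + nb + (nb + bilinear_norm c)) * (`|x| * `|y|))).
  rewrite !mulrDl; apply: le_trans (ler_normD _ _) _; apply: lerD.
    apply: le_trans (ler_normD _ _) _; apply: lerD; first exact: ub.
    by rewrite (mulrC `|x|); exact: ub.
  by apply: le_trans (ler_normB _ _) _; apply: lerD; exact: ub.
by rewrite -mulrA ler_wpM2r// lerDl.
Qed.

Section Stability.
Variables (alpha0 beta gamma0 : R).
Hypotheses (a_sym : forall v w, a v w = a w v) (a_ge0 : forall v, 0 <= a v v).
Hypotheses (c_sym : forall p q, c p q = c q p) (c_ge0 : forall q, 0 <= c q q).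
Hypotheses (alpha0_gt0 : 0 < alpha0) (beta_gt0 : 0 < beta) (gamma0_gt0 : 0 < gamma0).
Hypothesis a_coercive :
  forall v, cs_set (kerB b) v -> alpha0 * `|v| ^+ 2 <= a v v.
Hypothesis c_coercive :
  forall q, cs_set (kerBt b) q -> gamma0 * `|q| ^+ 2 <= c q q.
Hypothesis infsupQ : forall q, cs_set (orthc (kerBt b)) q ->
  beta * `|q| <= sup [set b v q / `|v| | v in [set v | v != 0]].
Hypothesis infsupV : forall v, cs_set (orthc (kerB b)) v ->
  beta * `|v| <= sup [set b v q / `|q| | q in [set q | q != 0]].

(* From [|u| + |p| <= L (n + sqrt (n (|u| + |p|)))], where [n] bounds the data. *)
Definition stability_const (al be ga A Cc : R) : R :=
  let r := 1 + Num.sqrt A + Num.sqrt Cc in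
  let L := r / be + r / be + (r + A * (r / be)) / al + (r + Cc * (r / be)) / ga in
  2 * L + L ^+ 2.

Local Notation Cs :=
  (stability_const alpha0 beta gamma0 (bilinear_norm a) (bilinear_norm c)).

Lemma stability_const_gt0 (al be ga A Cc : R) :
  0 < al -> 0 < be -> 0 < ga -> 0 <= A -> 0 <= Cc ->
  0 < stability_const al be ga A Cc.
Proof.
move=> al0 be0 ga0 A0 C0; rewrite /stability_const.
set r := 1 + _ + _; have r0 : 0 < r by rewrite /r -addrA ltr_pwDl// addr_ge0 ?sqrtr_ge0.
set L := _ + _ / ga; have L0 : 0 < L.
  have rb0 : 0 < r / be by rewrite divr_gt0.
  by rewrite /L !addr_gt0// divr_gt0// ltr_pwDl// mulr_ge0// ltW.
by rewrite addr_gt0 ?mulr_gt0 ?exprn_gt0.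
Qed.

Lemma ker_b v q : cs_set (kerB b) v -> b v q = 0.
Proof. by move=> Kv; have /= := congr1 (fun phi : topdual Q => phi q) Kv. Qed.

Lemma kert_b v q : cs_set (kerBt b) q -> b v q = 0.
Proof. by move=> Hq; have /= := congr1 (fun phi : topdual V => phi v) Hq. Qed.

Lemma saddle_stability (u : V) (p : Q) (n : R) : 0 <= n ->
  (forall v, `|a u v + b v p| <= n * `|v|) ->
  (forall q, `|b u q - c p q| <= n * `|q|) -> `|u| + `|p| <= Cs * n.
Proof.
move=> n0 hF hG; rewrite /stability_const.
set A := bilinear_norm a; set Cc := bilinear_norm c.
have A0 : 0 <= A by exact: bilinear_norm_ge0.
have C0 : 0 <= Cc by exact: bilinear_norm_ge0.
set rA := Num.sqrt A; set rC := Num.sqrt Cc.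
have rA0 : 0 <= rA by exact: sqrtr_ge0.
have rC0 : 0 <= rC by exact: sqrtr_ge0.
set s := `|u| + `|p|; have s0 : 0 <= s by rewrite addr_ge0.
pose sg := Num.sqrt (n * s).
have sg0 : 0 <= sg by exact: sqrtr_ge0.
have sg2 : sg ^+ 2 = n * s by rewrite sqr_sqrtr// mulr_ge0.
(* Testing the first equation with [u] and the second with [p] and subtracting cancels b(u, p), so
   |b| does not appear. *)
have energy : a u u + c p p <= sg ^+ 2.
  have -> : a u u + c p p = (a u u + b u p) - (b u p - c p p) by ring.
  apply: le_trans (ler_norm _) _; apply: le_trans (ler_normB _ _) _.
  by rewrite sg2 mulrDr lerD.
have au : a u u <= sg ^+ 2 by apply: le_trans energy; rewrite lerDl.
have cp : c p p <= sg ^+ 2 by apply: le_trans energy; rewrite lerDr.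
(* The whole functional a(u, .) is controlled by a(u, u), although a(u, u) does not control |u|
   outside the kernel. *)
have auv v : `|a u v| <= rA * sg * `|v|.
  rewrite -ler_sqr ?nnegrE ?mulr_ge0// real_normK ?num_real// !exprMn sqr_sqrtr//.
  apply: le_trans (psd_cauchy_schwarz _ _ a_sym a_ge0) _.
  rewrite (mulrC A) -mulrA ler_pM//; apply: le_trans (ler_norm _) _.
  by rewrite expr2 mulrA; exact: bilinear_norm_ub.
have cpq q : `|c p q| <= rC * sg * `|q|.
  rewrite -ler_sqr ?nnegrE ?mulr_ge0// real_normK ?num_real// !exprMn sqr_sqrtr//.
  apply: le_trans (psd_cauchy_schwarz _ _ c_sym c_ge0) _.
  rewrite (mulrC Cc) -mulrA ler_pM//; apply: le_trans (ler_norm _) _.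
  by rewrite expr2 mulrA; exact: bilinear_norm_ub.
pose u0 := orth_proj (kerB b) u; pose ub := orth_proj (orthc (kerB b)) u.
pose p0 := orth_proj (kerBt b) p; pose pb := orth_proj (orthc (kerBt b)) p.
have uE : u = u0 + ub := proj_orthc (kerB b) u.
have pE : p = p0 + pb := proj_orthc (kerBt b) p.
have Ku0 : cs_set (kerB b) u0 by exact: proj_in.
have Hp0 : cs_set (kerBt b) p0 by exact: proj_in.
have bpb v : b v pb = b v p by rewrite [in RHS]pE linearDr/= (kert_b _ Hp0) add0r.
have bub q : b ub q = b u q by rewrite [in RHS]uE linearDl/= (ker_b _ Ku0) add0r.
have hpb : beta * `|pb| <= n + rA * sg.
  apply: le_trans (infsupQ _) _; first exact: proj_in.
  apply: sup_quotient_le => [|v]; first by rewrite addr_ge0 ?mulr_ge0.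
  rewrite bpb (_ : b v p = (a u v + b v p) - a u v); last by ring.
  apply: le_trans (ler_norm _) _; apply: le_trans (ler_normB _ _) _.
  by rewrite mulrDl lerD.
have hub : beta * `|ub| <= n + rC * sg.
  apply: le_trans (infsupV _) _; first exact: proj_in.
  apply: sup_quotient_le => [|q]; first by rewrite addr_ge0 ?mulr_ge0.
  rewrite bub (_ : b u q = (b u q - c p q) + c p q); last by ring.
  apply: le_trans (ler_norm _) _; apply: le_trans (ler_normD _ _) _.
  by rewrite mulrDl lerD.
(* Coercivity holds at the kernel part [w0] only. Writing d(w0, w0) = d(w, w0) - d(wb, w0) leaves
   [wb], which the inf-sup conditions bound. *)
have coer (W : hilbertType R) (d : cbilinear W W) (w w0 wb : W) (m r : R) :
    w = w0 + wb -> m * `|w0| ^+ 2 <= d w0 w0 -> 0 <= r ->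
    (forall z, `|d w z| <= r * `|z|) ->
    m * `|w0| <= r + bilinear_norm d * `|wb|.
  move=> wE md r0 dr; have [->|w00] := eqVneq w0 0.
    by rewrite normr0 mulr0 addr_ge0 ?mulr_ge0 ?bilinear_norm_ge0.
  have nw0 : 0 < `|w0| by rewrite normr_gt0.
  rewrite -(ler_pM2r nw0) -mulrA -expr2; apply: le_trans md _.
  have -> : d w0 w0 = d w w0 - d wb w0 by rewrite wE linearDl/= addrK.
  apply: le_trans (ler_norm _) _; apply: le_trans (ler_normB _ _) _.
  by rewrite mulrDl lerD// bilinear_norm_ub.
have hu0 := coer _ _ _ _ _ _ _ uE (a_coercive Ku0) (mulr_ge0 rA0 sg0) auv.
have hp0 := coer _ _ _ _ _ _ _ pE (c_coercive Hp0) (mulr_ge0 rC0 sg0) cpq.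
set r := 1 + rA + rC.
have r0 : 0 <= r by rewrite /r -addrA addr_ge0// addr_ge0.
set t := n + sg; have t0 : 0 <= t by rewrite addr_ge0.
(* The coefficient r = 1 + sqrt |a| + sqrt |c| dominates all the others, so the four components get
   bounds with the same factor t = n + sg. *)
have rt : n + rA * sg <= r * t /\ n + rC * sg <= r * t /\ rA * sg <= r * t /\ rC * sg <= r * t.
  have := mulr_ge0 rA0 sg0; have := mulr_ge0 rC0 sg0.
  have := mulr_ge0 rA0 n0; have := mulr_ge0 rC0 n0.
  by rewrite /r /t; move=> *; repeat split; nra.
have [rt1 [rt2 [rt3 rt4]]] := rt.
have b1 : `|pb| <= r / beta * t.
  by rewrite mulrAC ler_pdivlMr// mulrC; apply: le_trans hpb _.
have b2 : `|ub| <= r / beta * t.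
  by rewrite mulrAC ler_pdivlMr// mulrC; apply: le_trans hub _.
have b3 : `|u0| <= (r + A * (r / beta)) / alpha0 * t.
  rewrite mulrAC ler_pdivlMr// mulrC; apply: le_trans hu0 _.
  by rewrite mulrDl lerD// -mulrA ler_wpM2l.
have b4 : `|p0| <= (r + Cc * (r / beta)) / gamma0 * t.
  rewrite mulrAC ler_pdivlMr// mulrC; apply: le_trans hp0 _.
  by rewrite mulrDl lerD// -mulrA ler_wpM2l.
set L := _ + _ / gamma0.
have sL : s <= L * t.
  have nu : `|u| <= `|u0| + `|ub| by rewrite uE; exact: ler_normD.
  have np : `|p| <= `|p0| + `|pb| by rewrite pE; exact: ler_normD.
  rewrite /L [leRHS]mulrDl [(_ + _ + _) * t]mulrDl [(_ + _) * t]mulrDl.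
  apply: le_trans (lerD nu np) _.
  by move: b1 b2 b3 b4; set x1 := _ * t; set x2 := _ * t; set x3 := _ * t; lra.
have rb0 : 0 <= r / beta by rewrite divr_ge0// ltW.
have L0 : 0 <= L.
  have al := ltW alpha0_gt0; have ga := ltW gamma0_gt0.
  have Ar := mulr_ge0 A0 rb0; have Cr := mulr_ge0 C0 rb0.
  by rewrite /L !addr_ge0// divr_ge0// addr_ge0.
(* Young's inequality for sg = sqrt (n s): half of [s] is absorbed on the left, and the coefficient
   2 L + L^2 of [n] remains. *)
have Lsg : L * sg <= (s + L ^+ 2 * n) / 2.
  have Ln := mulr_ge0 (sqr_ge0 L) n0.
  rewrite -ler_sqr ?nnegrE ?(mulr_ge0 L0)// ?divr_ge0 ?addr_ge0//.
  rewrite exprMn sg2; have := sqr_ge0 (s - L ^+ 2 * n).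
  have e4 : (2 : R) ^+ 2 = 4 by ring.
  by rewrite expr_div_n e4 ler_pdivlMr //; nra.
by move: sL Lsg; rewrite /t mulrDr; lra.
Qed.

Lemma saddle_op_lower (x : hprod V Q) : `|x| <= Cs * `|saddle_op x|.
Proof.
apply: le_trans (hprod_norm_le x) _; apply: saddle_stability => // [v|q].
  have -> : a x.1 v + b v x.2 = inner (saddle_op x) (v, 0).
    by rewrite saddle_opE /saddle_form/= !linear0r subrr addr0.
  apply: le_trans (cauchy_schwarz _ _) _; rewrite ler_wpM2l//.
  by apply: le_trans (hprod_norm_le _) _; rewrite normr0 addr0.
have -> : b x.1 q - c x.2 q = inner (saddle_op x) (0, q).
  by rewrite saddle_opE /saddle_form/= linear0r linear0l !add0r.
apply: le_trans (cauchy_schwarz _ _) _; rewrite ler_wpM2l//.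
by apply: le_trans (hprod_norm_le _) _; rewrite normr0 add0r.
Qed.

Lemma saddle_op_sym x y : inner (saddle_op x) y = inner x (saddle_op y).
Proof.
rewrite [RHS]innerC !saddle_opE /saddle_form (a_sym y.1) (c_sym y.2); ring.
Qed.

Lemma saddle_inverse : exists S : {linear hprod V Q -> hprod V Q},
  [/\ cancel S saddle_op, cancel saddle_op S & forall z, `|S z| <= Cs * `|z|].
Proof.
have [N N0 hN] := saddle_op_bounded.
have Cs0 : 0 < Cs by apply: stability_const_gt0; rewrite ?bilinear_norm_ge0.
have inj x y : saddle_op x = saddle_op y -> x = y.
  move=> xy; apply/eqP; rewrite -subr_eq0 -normr_le0.
  apply: le_trans (saddle_op_lower _) _.
  by rewrite linearB/= xy subrr normr0 mulr0.
have /choice[S SK] : forall z, exists x, saddle_op x = z.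
  exact: (symmetric_bounded_below_surj N0 Cs0 hN saddle_op_lower saddle_op_sym).
have Slin : linear S.
  by move=> k x y; apply: inj; rewrite SK saddle_op_linear !SK.
pose lS : {linear hprod V Q -> hprod V Q} :=
  HB.pack S (GRing.isLinear.Build R (hprod V Q) (hprod V Q) _ S Slin).
exists lS; split=> // [x|z]; first by apply: inj; rewrite /= SK.
by apply: le_trans (saddle_op_lower _) _; rewrite /= SK.
Qed.
End Stability.
End SaddlePoint.

(** * Integrals and null sets without measurability *)

Section AlmostEverywhereIntegral.
Context d (T : measurableType d) (R : realType) (mu : {measure set T -> \bar R}).
Import HBNNSimple.

(* The integrands need not be measurable: a simple function below [f] is cut
   off to zero on the exceptional null set. *)
Lemma ae_le_integral_nonmeasurable (D : set T) (f g : T -> \bar R) :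
  (forall x, D x -> 0 <= f x)%E -> (forall x, D x -> 0 <= g x)%E ->
  {ae mu, forall x, D x -> (f x <= g x)%E} ->
  (\int[mu]_(x in D) f x <= \int[mu]_(x in D) g x)%E.
Proof.
move=> f0 g0 [N [mN muN fgN]].
rewrite !ge0_integralE//=; apply: ge_ereal_sup => _ [h /= hf <-].
pose h' := proj_nnsfun h (measurableC mN).
have -> : sintegral mu h = sintegral mu h'.
  rewrite -!integralT_nnsfun.
  apply: ge0_ae_eq_integral => //.
  - exact/measurable_EFinP.
  - exact/measurable_EFinP.
  - by move=> x _; rewrite lee_fin.
  - by move=> x _; rewrite lee_fin.
  exists N; split => // x /= hx; apply: contrapT => Nx; apply: hx => _.
  congr (_%:E); rewrite [RHS](_ : _ = h x * \1_(~` N) x)//.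
  by rewrite indicE mem_set//= mulr1.
apply: ereal_sup_ubound; exists h' => // x.
change ((h x * \1_(~` N) x)%:E <= (g \_ D) x)%E; rewrite indicE; have [Nx|Nx] := pselect (N x).
  rewrite (_ : (x \in _) = false) ?mulr0; first exact: erestrict_ge0.
  by apply/negP => /set_mem.
rewrite mem_set//= mulr1; apply: le_trans (hf x) _.
rewrite /patch; case: ifPn => // /set_mem Dx; apply: contrapT => fg.
by apply: Nx; apply: fgN => /= /(_ Dx).
Qed.

Lemma ae_eq_integral_nonmeasurable (D : set T) (f g : T -> \bar R) :
  {ae mu, forall x, D x -> f x = g x} ->
  (\int[mu]_(x in D) f x = \int[mu]_(x in D) g x)%E.
Proof.
move=> fg; rewrite integralE [RHS]integralE.
by congr (_ - _)%E; apply/eqP; rewrite eq_le; apply/andP; split;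
  apply: ae_le_integral_nonmeasurable => //;
  (apply: filterS fg => x fg Dx; rewrite ?funeposE ?funenegE fg).
Qed.

Lemma ae_eq_Rintegral (D : set T) (f g : T -> R) :
  {ae mu, forall x, D x -> f x = g x} ->
  \int[mu]_(x in D) f x = \int[mu]_(x in D) g x.
Proof.
move=> fg; congr fine; apply: ae_eq_integral_nonmeasurable.
by apply: filterS fg => x fg Dx; rewrite fg.
Qed.
End AlmostEverywhereIntegral.

(** * Pointwise limits of simple functions *)

Section SimpleLimit.
Context {R : realType}.
Local Notation mu := (@lebesgue_measure R).
Local Notation D T := [set t : measurableTypeR R | 0 <= t <= T].

(** Convergence at every real, whereas [strongly_measurable] asks for it at almost every point of
    [0, T]: the norm is then Borel, and composition with continuous maps creates no exceptional
    set. *)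
Definition simple_limit (B : normedModType R) (f : R -> B) :=
  exists s : nat -> R -> B,
    (forall n, simple_function (s n)) /\ forall t, s n t @[n --> \oo] --> f t.

Lemma simple_function_preimage (B : normedModType R) (s : R -> B) (A : set B) :
  simple_function s -> measurable (s @^-1` A : set (measurableTypeR R)).
Proof.
move=> [fs ms].
have -> : s @^-1` A = \bigcup_(x in range s `&` A) s @^-1` [set x].
  apply/seteqP; split=> [t At|t [x [_ Ax] /= ->//]].
  by exists (s t) => //; split => //; exists t.
by apply: fin_bigcup_measurable => [|x _]; [exact: finite_setIl|exact: ms].
Qed.

Lemma simple_function_comp (B C : normedModType R) (s : R -> B) (L : B -> C) :
  simple_function s -> simple_function (L \o s).
Proof.
move=> hs; split; last by move=> x; rewrite comp_preimage; exact: simple_function_preimage.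
have [fs _] := hs; apply: sub_finite_set (finite_image L fs) => _ [t _ <-].
by exists (s t) => //; exists t.
Qed.

Lemma simple_function_pair (B C : normedModType R) (s : R -> B) (r : R -> C) :
  simple_function s -> simple_function r -> simple_function (fun t => (s t, r t)).
Proof.
move=> [fs ms] [fr mr]; split.
  apply: (sub_finite_set _ (finite_setX fs fr)) => _ [t _ <-].
  by split; exists t.
move=> [x y].
have -> : (fun t => (s t, r t)) @^-1` [set (x, y)] =
    s @^-1` [set x] `&` r @^-1` [set y].
  by apply/seteqP; split=> t /= [-> ->].
exact: measurableI.
Qed.

Lemma simple_limit_comp (B C : normedModType R) (f : R -> B) (L : B -> C) :
  simple_limit f -> continuous L -> simple_limit (fun t => L (f t)).
Proof.
move=> [s [ss sf]] cL; exists (fun n => L \o s n); split=> [n|t].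
  exact: simple_function_comp.
exact: (continuous_cvg _ (cL _) (sf t)).
Qed.

Lemma simple_limit_pair (B C : normedModType R) (f : R -> B) (g : R -> C) :
  simple_limit f -> simple_limit g -> simple_limit (fun t => (f t, g t)).
Proof.
move=> [s [ss sf]] [r [rr rg]]; exists (fun n t => (s n t, r n t)); split=> [n|t].
  exact: simple_function_pair.
exact: cvg_pair.
Qed.

Lemma simple_limitD (B : normedModType R) (f g : R -> B) :
  simple_limit f -> simple_limit g -> simple_limit (fun t => f t + g t).
Proof.
move=> hf hg; apply: (simple_limit_comp (simple_limit_pair hf hg) (L := fun z => z.1 + z.2)).
move=> z; apply: cvgD; [exact: cvg_fst|exact: cvg_snd].
Qed.

Lemma simple_limitZ (B : normedModType R) (k : R -> R) (f : R -> B) :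
  simple_limit k -> simple_limit f -> simple_limit (fun t => k t *: f t).
Proof.
move=> hf hg; apply: (simple_limit_comp (simple_limit_pair hf hg)
  (L := fun z : R^o * B => (z.1 : R) *: z.2)).
move=> z; apply: cvgZ; [exact: cvg_fst|exact: cvg_snd].
Qed.

Lemma simple_limit_measurable (f : R -> R) :
  simple_limit f -> measurable_fun setT (f : measurableTypeR R -> _).
Proof.
move=> [s [ss sf]]; apply: (@measurable_fun_cvg _ (measurableTypeR R) R setT s).
  by move=> n _ Y mY; rewrite setTI; exact: simple_function_preimage.
by move=> t _; exact: sf.
Qed.

Import HBSimple.

Lemma measurable_simple_limit (f : R -> R) :
  measurable_fun setT (f : measurableTypeR R -> _) -> simple_limit f.
Proof.
move=> /measurable_EFinP mf.
have [g gf] := approximation_sfun measurableT mf.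
exists (fun n => g n); split=> [n|t].
  split; [exact: (@fimfunP _ _ (g n))|move=> x].
  by rewrite -[X in measurable X]setTI; exact: (measurable_funP (g n) measurableT _ (measurable_set1 x)).
by have /fine_cvgP[_] := gf t I.
Qed.

Lemma simple_function_indic (E : set (measurableTypeR R)) :
  measurable E -> simple_function (\1_E : R -> R^o).
Proof.
move=> mE; split.
  apply: (sub_finite_set (B := [set 0; 1])); last exact: finite_set2.
  by move=> _ [t _ <-]; rewrite indicE; case: (_ \in _); [right|left].
move=> x; rewrite -[X in measurable X]setTI.
have : measurable_fun setT (\1_E : measurableTypeR R -> R).
  exact: measurable_indic.
by apply => //; exact: measurable_set1.
Qed.

(** Multiplying the approximants by the indicator of [0, T] minus a measurable null set that
    contains the bad points makes them converge everywhere, with limit 0 outside. *)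
Lemma strongly_measurable_simple_limit (B : normedModType R) (T : R) (f : R -> B) :
  strongly_measurable T f ->
  exists2 f', simple_limit f' & {ae mu, forall t, 0 <= t <= T -> f' t = f t}.
Proof.
move=> [s [ss [N [mN muN sN]]]].
pose E : set (measurableTypeR R) := `[0, T]%classic `\` N.
have mE : measurable E by apply: measurableD => //; exact: measurable_itv.
have i1 t : 0 <= t <= T -> ~ N t -> \1_E t = 1 :> R.
  by move=> tT Nt; rewrite indicE mem_set//; split; rewrite //= in_itv.
exists (fun t => (\1_E t : R) *: f t); last first.
  exists N; split=> // t /=; apply: contra_notP => Nt tT.
  by rewrite (i1 t tT Nt) scale1r.
exists (fun n t => (\1_E t : R) *: s n t); split=> [n|t].
  exact: (simple_function_comp (fun z : R^o * B => (z.1 : R) *: z.2)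
           (simple_function_pair (simple_function_indic mE) (ss n))).
rewrite indicE; have [Et|Et] := boolP (t \in E); last first.
  by under eq_fun do rewrite scale0r; rewrite scale0r; exact: cvg_cst.
apply: cvgZl_tmp; have [tT Nt] := set_mem Et.
apply: contrapT => h; apply: Nt; apply: sN => /= h'; apply/h/h'.
by move: tT; rewrite /= in_itv.
Qed.

Lemma simple_limit_strongly_measurable (B : normedModType R) (T : R) (f : R -> B) :
  simple_limit f -> strongly_measurable T f.
Proof. by move=> [s [ss sf]]; exists s; split=> //; apply: aeW => t _; exact: sf. Qed.

Lemma simple_limit_norm (B : normedModType R) (f : R -> B) :
  simple_limit f -> measurable_fun setT (fun t : measurableTypeR R => `|f t|).
Proof.
move=> hf; apply: simple_limit_measurable.
by apply: (simple_limit_comp hf (L := fun z => `|z| : R^o)) => z; exact: norm_continuous.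
Qed.
End SimpleLimit.

(** * Weak integrals of Hilbert-valued functions *)

Section WeakIntegral.
Context {R : realType} {X : hilbertType R}.
Local Notation mu := (@lebesgue_measure R).
Variable D : set (measurableTypeR R).
Hypothesis mD : measurable D.

Definition norm_integrable (z : R -> X) :=
  simple_limit z /\ mu.-integrable D (fun s => `|z s|%:E).

Lemma dominated_integrable_real (f g : measurableTypeR R -> R) :
  measurable_fun setT f -> (forall s, D s -> `|f s| <= g s) ->
  mu.-integrable D (EFin \o g) -> mu.-integrable D (EFin \o f).
Proof.
move=> mf fg; apply: le_integrable => // [|s Ds /=].
  by apply/measurable_EFinP; exact: measurable_funTS.
by rewrite lee_fin (le_trans (fg s Ds))// ler_norm.
Qed.

Lemma norm_integrable_le (z : R -> X) (g : measurableTypeR R -> R) :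
  simple_limit z -> (forall s, D s -> `|z s| <= g s) ->
  mu.-integrable D (EFin \o g) -> norm_integrable z.
Proof.
move=> hz zg ig; split=> //; apply: (dominated_integrable_real _ _ ig).
  exact: simple_limit_norm.
by move=> s Ds; rewrite normr_id; exact: zg.
Qed.

Lemma norm_integrableD (y z : R -> X) :
  norm_integrable y -> norm_integrable z -> norm_integrable (fun s => y s + z s).
Proof.
move=> [hy iy] [hz iz]; apply: (norm_integrable_le (g := fun s => `|y s| + `|z s|)).
- exact: simple_limitD.
- by move=> s _; exact: ler_normD.
by have := integrableD mD iy iz.
Qed.

Lemma norm_integrableN (z : R -> X) :
  norm_integrable z -> norm_integrable (fun s => - z s).
Proof.
move=> [hz iz]; apply: (norm_integrable_le (g := fun s => `|z s|)) => //.
  by apply: (simple_limit_comp hz) => x; exact: opp_continuous.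
by move=> s _; rewrite normrN.
Qed.

Lemma norm_integrableB (y z : R -> X) :
  norm_integrable y -> norm_integrable z -> norm_integrable (fun s => y s - z s).
Proof. by move=> hy hz; exact: (norm_integrableD hy (norm_integrableN hz)). Qed.

Lemma inner_integrable (z : R -> X) (xi : X) :
  norm_integrable z -> mu.-integrable D (fun s => (inner (z s) xi)%:E).
Proof.
move=> [hz iz].
apply: (dominated_integrable_real (g := fun s => `|xi| * `|z s|)).
- apply: (simple_limit_measurable (f := fun s => inner (z s) xi)).
  apply: (simple_limit_comp hz (L := fun x => inner x xi : R^o)).
  rewrite (_ : (fun x => _) = inner xi); first exact: inner_continuous.
  by apply/funext => x; rewrite innerC.
- by move=> s _; rewrite mulrC; exact: cauchy_schwarz.
by have := integrableZl mD `|xi| iz.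
Qed.

(** The Pettis integral: identities between vectors become identities between scalar Lebesgue
    integrals, which is also the form in which the system is stated. *)
Definition is_weak_integral (z : R -> X) (w : X) :=
  forall xi, inner w xi = \int[mu]_(s in D) inner (z s) xi.

Lemma weak_integral_ub (z : R -> X) xi : norm_integrable z ->
  `|\int[mu]_(s in D) inner (z s) xi| <= (\int[mu]_(s in D) `|z s|) * `|xi|.
Proof.
move=> hz; have [_ iz] := hz.
apply: le_trans (le_normr_Rintegral mD (inner_integrable xi hz)) _.
rewrite -RintegralZr//; apply: le_Rintegral => //.
- by have := integrable_abse (inner_integrable xi hz).
- by have := integrableZr mD `|xi| iz.
by move=> s _; exact: cauchy_schwarz.
Qed.

Lemma weak_integral_ex (z : R -> X) :
  norm_integrable z -> exists w, is_weak_integral z w.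
Proof.
move=> hz; pose F xi := \int[mu]_(s in D) inner (z s) xi.
have Flin : linear F.
  move=> k x y; rewrite /F /GRing.scale/= -RintegralZl//; last exact: inner_integrable.
  rewrite -RintegralD//; last 2 first.
  - by have := integrableZl mD k (inner_integrable x hz).
  - exact: inner_integrable.
  by apply: eq_Rintegral => s _; rewrite innerPr.
pose L : {linear X -> R^o} := HB.pack F (GRing.isLinear.Build R X R^o _ F Flin).
have cF : continuous F.
  apply: (@linear_norm_le_continuous R X R^o L (\int[mu]_(s in D) `|z s|)).
  by move=> xi; exact: weak_integral_ub.
have dF : F \in dual_pred X by apply/dual_predE.
by have [w hw] := riesz_ex (Dual dF); exists w.
Qed.

Lemma weak_integral_norm (z : R -> X) w : norm_integrable z ->
  is_weak_integral z w -> `|w| <= \int[mu]_(s in D) `|z s|.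
Proof.
move=> hz hw; apply: norm_le_inner => [|xi].
  by apply: Rintegral_ge0.
by rewrite hw; apply: le_trans (ler_norm _) _; exact: weak_integral_ub.
Qed.

Lemma weak_integralB (y z : R -> X) v w : norm_integrable y -> norm_integrable z ->
  is_weak_integral y v -> is_weak_integral z w ->
  is_weak_integral (fun s => y s - z s) (v - w).
Proof.
move=> iy iz hv hw xi; rewrite innerBl hv hw -RintegralB//; try exact: inner_integrable.
by apply: eq_Rintegral => s _; rewrite innerBl.
Qed.

(* The default value 0 is only used when [z] is not [norm_integrable]. *)
Definition weak_integral (z : R -> X) : X := xget 0 (is_weak_integral z).

Lemma weak_integralP (z : R -> X) :
  norm_integrable z -> is_weak_integral z (weak_integral z).
Proof. by move=> /weak_integral_ex[w hw]; exact: (xgetI 0 hw). Qed.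
End WeakIntegral.

(** * Tools for the Picard iteration *)

Lemma geometric_half_small (R : realType) (K e : R) : 0 < e ->
  exists N, forall n, (N <= n)%N -> K * 2^-1 ^+ n < e.
Proof.
move=> e0.
have cg : K * 2^-1 ^+ n @[n --> \oo] --> (0 : R).
  rewrite -(mulr0 K); apply: cvgMl_tmp; apply: cvg_expr.
  by rewrite gtr0_norm ?invr_gt0// invf_lt1// ltr1n.
move/cvgrPdist_lt: cg => /(_ e e0)[N _ hN]; exists N => n Nn.
apply: le_lt_trans (ler_norm _) _.
by have := hN n Nn; rewrite /= sub0r normrN.
Qed.

Lemma geometric_increments_cvg (R : realType) (X : completeNormedModType R)
    (u : nat -> X) (K : R) :
  (forall n, `|u n.+1 - u n| <= K * 2^-1 ^+ n.+1) ->
  exists l, forall n, `|l - u n| <= K * 2^-1 ^+ n.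
Proof.
move=> hu; have h0 n : 0 <= 2^-1 ^+ n :> R by rewrite exprn_ge0// invr_ge0.
have K0 : 0 <= K.
  have := le_trans (normr_ge0 _) (hu 0%N).
  by rewrite pmulr_lge0// exprn_gt0// invr_gt0.
(* The factor 1 - 2^-m, rather than 1, makes the induction on [m] close. *)
have tail m n : `|u (n + m)%N - u n| <= K * 2^-1 ^+ n * (1 - 2^-1 ^+ m).
  elim: m => [|m IH]; first by rewrite addn0 subrr normr0 expr0 subrr mulr0.
  rewrite addnS; apply: le_trans (ler_distD (u (n + m)%N) _ _) _.
  apply: le_trans (lerD (hu _) IH) _.
  by rewrite -addnS exprD exprS; set p := 2^-1 ^+ n; set q := 2^-1 ^+ m; lra.
have tailn n j : (n <= j)%N -> `|u j - u n| <= K * 2^-1 ^+ n.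
  move=> nj; rewrite -(subnKC nj); apply: le_trans (tail _ _) _.
  by rewrite ler_piMr ?mulr_ge0// gerBl.
have cu : cvg (u @ \oo).
  apply: cauchy_cvg; apply: cauchy_exP => e e0.
  have [N hN] := geometric_half_small K e0; exists (u N); exists N => // n /= Nn.
  by rewrite -ball_normE /= distrC; apply: le_lt_trans (tailn _ _ Nn) (hN N _).
exists (lim (u @ \oo)) => n.
have cn : `|u j - u n| @[j --> \oo] --> `|lim (u @ \oo) - u n|.
  by apply: cvg_norm; apply: cvgB => //; exact: cvg_cst.
rewrite -(cvg_lim _ cn)//; apply: limr_le; first by apply/cvg_ex; eexists; exact: cn.
by exists n => // j /= nj; exact: tailn.
Qed.

(** Composing [w] with simple functions that converge to the identity gives simple functions, and
    sequential continuity gives their limit. *)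
Lemma seq_continuous_simple_limit (R : realType) (B : normedModType R) (w : R -> B) :
  (forall (tau : nat -> R) t, tau n @[n --> \oo] --> t ->
     w (tau n) @[n --> \oo] --> w t) ->
  simple_limit w.
Proof.
move=> cw; have [s [ss sid]] : simple_limit (id : R -> R).
  exact/measurable_simple_limit/measurable_id.
exists (fun n => w \o s n); split=> [n|t]; first exact: simple_function_comp.
exact: cw.
Qed.

(** With k = 2 M, a Volterra kernel bounded by M contracts the norm weighted by this exponential
    with factor M / (2 M) = 1 / 2, whatever the length T. *)
Lemma Rintegral_expR_le (R : realType) (k t : R) : 0 < k -> 0 <= t ->
  \int[@lebesgue_measure R]_(s in `[0, t]) expR (k * s) <= k^-1 * expR (k * t).
Proof.
move=> k0; rewrite le_eqVlt => /predU1P[<-|t0].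
  by rewrite set_itv1 Rintegral_set1 mulr_ge0 ?expR_ge0// ltW// invr_gt0.
have ce : continuous (fun s : R^o => expR (k * s)).
  move=> s; apply: continuous_comp; last exact: continuous_expR.
  by apply: continuousM => //; exact: cst_continuous.
have cF : continuous (fun s : R^o => k^-1 * expR (k * s)).
  by move=> s; apply: (@cvgMl_tmp R _ (nbhs s) _ (fun s : R^o => expR (k * s)) k^-1 _); exact: ce.
rewrite /Rintegral (@continuous_FTC2 _ _ (fun s => k^-1 * expR (k * s)))//.
- by rewrite /= mulr0 expR0 mulr1 gerBl ltW// invr_gt0.
- exact: continuous_subspaceT.
- split.
  + by move=> z _; exact: ex_derive.
  + by apply/cvg_at_right_filter; exact: cF.
  + by apply/cvg_at_left_filter; exact: cF.
move=> z _; rewrite derive1Ml; last exact: ex_derive.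
rewrite derive1_comp// derive1Ml// derive1_id mulr1 derive1E.
have /funeqP -> := @derive_expR R.
by rewrite mulrC mulfK// gt_eqF.
Qed.

Section Clamp.
Context {R : realType}.
Variable T : R.

(** The retraction of the line onto [0, T] for T >= 0; functions of time thereby become total, with
    continuity at every real. *)
Definition clamp (t : R) : R := Num.max 0 (Num.min t T).

Lemma clamp_id t : 0 <= t <= T -> clamp t = t.
Proof. by move=> /andP[t0 tT]; rewrite /clamp min_l// max_r. Qed.

Lemma clamp_itv t : 0 <= T -> 0 <= clamp t <= T.
Proof. by move=> T0; rewrite /clamp le_max lexx /= ge_max T0 ge_min lexx orbT. Qed.

Lemma clamp_continuous : continuous clamp.
Proof.
apply: (@max_fun_continuous _ R R (cst 0) (fun t => Num.min t T)).
  exact: cst_continuous.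
apply: (@min_fun_continuous _ R R id (cst T)); last exact: cst_continuous.
by move=> t; exact: cvg_id.
Qed.
End Clamp.

(** Over the fixed interval [0, T], integrals for different [t] can be compared and dominated
    convergence applies as [t] moves. *)
Lemma Rintegral_indic_itv (R : realType) (T t : R) (f : R -> R) : t <= T ->
  \int[@lebesgue_measure R]_(s in `[0, T]) ((\1_(`]-oo, t]) s : R) * f s) =
  \int[@lebesgue_measure R]_(s in `[0, t]) f s.
Proof.
move=> tT; have -> : `[0, t]%classic = `[0, T]%classic `&` `]-oo, t]%classic.
  apply/seteqP; split=> s /=; rewrite !in_itv/=.
    by move=> /andP[-> st]; rewrite st (le_trans st).
  by move=> [/andP[-> _] ->].
rewrite Rintegral_mkcondr; apply: eq_Rintegral => s _.
by rewrite patchE indicE; case: (_ \in _); rewrite ?mul1r ?mul0r.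
Qed.

(** * Existence for a Volterra equation with a bounded kernel *)

Section VolterraExistence.
Context {R : realType} {X : hilbertType R}.
Local Notation mu := (@lebesgue_measure R).
Variables (T M : R) (G : R -> R -> X -> X).
Hypotheses (T0 : 0 <= T) (M0 : 0 < M).
Hypothesis G_continuous1 : forall s x, continuous (fun t : R => G t s x).
Hypothesis G_continuous2 : forall t, continuous (fun v : R^o * X => G t v.1 v.2).
Hypothesis GB : forall t s x y, G t s (x - y) = G t s x - G t s y.
Hypothesis GM : forall t s x, `|G t s x| <= M * `|x|.
Local Notation I := (`[0, T]%classic : set (measurableTypeR R)).

Let mI : measurable I. Proof. exact: measurable_itv. Qed.

Local Notation c := (clamp T).

Let c_cvg (tau : nat -> R) t :
  tau n @[n --> \oo] --> t -> c (tau n) @[n --> \oo] --> c t.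
Proof. by apply: continuous_cvg; exact: clamp_continuous. Qed.

Let Gz (z : R -> X) (t s : R) : X := (\1_(`]-oo, c t]) s : R) *: G (c t) s (z s).

Let Gz_simple z t : simple_limit z -> simple_limit (Gz z t).
Proof.
move=> hz; apply: (simple_limitZ (k := \1_(`]-oo, c t]))).
  by apply: measurable_simple_limit; exact: measurable_indic.
have hid : simple_limit (id : R -> R) by exact/measurable_simple_limit/measurable_id.
exact: (simple_limit_comp (simple_limit_pair hid hz) (@G_continuous2 (c t))).
Qed.

Let Gz_le z t s : `|Gz z t s| <= (\1_(`]-oo, c t]) s : R) * (M * `|z s|).
Proof. by rewrite normrZ normr_nat// ler_wpM2l. Qed.

Let Gz_le' z t s : `|Gz z t s| <= M * `|z s|.
Proof.
apply: le_trans (Gz_le z t s) _; rewrite ler_piMl ?mulr_ge0// ?(ltW M0)//.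
Qed.

Let Gz_int z t : norm_integrable I z -> norm_integrable I (Gz z t).
Proof.
move=> [hz iz]; apply: (norm_integrable_le mI (g := fun s => M * `|z s|)).
- exact: Gz_simple.
- by move=> s _; exact: Gz_le'.
by have := integrableZl mI M iz.
Qed.

Let Op (z : R -> X) (t : R) : X := weak_integral I (Gz z t).

Let OpP z t : norm_integrable I z -> is_weak_integral I (Gz z t) (Op z t).
Proof. by move=> hz; apply: weak_integralP => //; exact: Gz_int. Qed.

Let OpB z z' t : norm_integrable I z -> norm_integrable I z' ->
  `|Op z t - Op z' t| <=
    \int[mu]_(s in `[0, c t]) (M * `|z s - z' s|).
Proof.
move=> hz hz'; rewrite -(@Rintegral_indic_itv _ T); last first.
  by have /andP[] := clamp_itv t T0.
have hB := norm_integrableB mI hz hz'.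
have h : is_weak_integral I (Gz (fun s => z s - z' s) t) (Op z t - Op z' t).
  move=> xi; rewrite (weak_integralB mI _ _ (OpP t hz) (OpP t hz')); try exact: Gz_int.
  by apply: eq_Rintegral => s _; rewrite /Gz GB scalerBr.
apply: le_trans (weak_integral_norm mI (Gz_int t hB) h) _.
have iM : mu.-integrable I (fun s => (M * `|z s - z' s|)%:E).
  by have [_ iB] := hB; have := integrableZl mI M iB.
apply: le_Rintegral => //; first by have [] := Gz_int t hB.
  apply: (dominated_integrable_real mI (g := fun s => M * `|z s - z' s|)) => //.
    apply: measurable_funM; first exact: measurable_indic.
    by apply: measurable_funM => //; apply: simple_limit_norm; have [] := hB.
  move=> s _; rewrite normrM normr_nat [`|M * _|]ger0_norm ?mulr_ge0// ?(ltW M0)//.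
  by rewrite ler_piMl ?mulr_ge0 ?(ltW M0)// lern1; case: (_ \in _).
by move=> s _; exact: Gz_le.
Qed.

(** Dominated convergence with bound 2 M |z s|. This continuity in [t] is what makes [Op z] a limit
    of simple functions. *)
Let Op_cvg z (tau : nat -> R) t : norm_integrable I z ->
  tau n @[n --> \oo] --> t -> Op z (tau n) @[n --> \oo] --> Op z t.
Proof.
move=> hz /c_cvg ct.
pose f n s := `|Gz z (tau n) s - Gz z t s|.
have fint n : mu.-integrable I (EFin \o f n).
  by have [] := norm_integrableB mI (Gz_int (tau n) hz) (Gz_int t hz).
suff f0 : \int[mu]_(s in I) f n s @[n --> \oo] --> (0 : R).
  apply/cvgrPdist_le => e e0; move/cvgrPdist_le: f0 => /(_ e e0).
  apply: filterS => n; rewrite sub0r normrN; apply: le_trans.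
  apply: le_trans _ (ler_norm _); rewrite distrC.
  apply: (weak_integral_norm mI (norm_integrableB mI (Gz_int (tau n) hz) (Gz_int t hz))).
  by apply: weak_integralB => //; try exact: Gz_int; exact: OpP.
have [hzs iz] := hz.
have [] := @dominated_convergence _ (measurableTypeR R) R mu I mI (fun n => EFin \o f n)
  (cst 0%E) (fun s => (2 * M * `|z s|)%:E).
- by move=> n; have /integrableP[] := fint n.
- exact: measurable_cst.
(* The cut-off jumps at s = c t only, and convergence may fail there. *)
- exists [set c t]; split; [exact: measurable_set1|exact: lebesgue_measure_set1|].
  move=> s /=; apply: contra_notP => /eqP sc _.
  apply/fine_cvgP; split; first by apply: nearW.
  suff h : Gz z (tau n) s @[n --> \oo] --> Gz z t s.
    have := cvg_norm (cvgB h (cvg_cst (Gz z t s))).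
    by rewrite subrr normr0; apply.
  have Gc : G (c (tau n)) s (z s) @[n --> \oo] --> G (c t) s (z s).
    exact: (continuous_cvg _ (@G_continuous1 s (z s) (c t)) ct).
  have [sct|sct|/eqP] := ltgtP s (c t); last by rewrite (negbTE sc).
    have -> : Gz z t s = G (c t) s (z s).
      by rewrite /Gz indicE mem_set ?scale1r//= in_itv/= ltW.
    apply: cvg_trans Gc; apply: near_eq_cvg.
    have cs := cvgr_gt _ ct _ sct; near=> n; have sn : s < c (tau n) by near: n; exact: cs.
    by rewrite /Gz indicE mem_set ?scale1r//= in_itv/= ltW.
  have Gz0 r : c r < s -> Gz z r s = 0.
    move=> rs; rewrite /Gz indicE (_ : (s \in _) = false) ?scale0r//.
    by apply/negP => /set_mem /=; rewrite in_itv/= leNgt rs.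
  rewrite Gz0//; apply: cvg_trans (@cvg_cst _ (0 : X) _ \oo _).
  apply: near_eq_cvg; have cs := cvgr_lt _ ct _ sct.
  by near=> n; have sn : c (tau n) < s by [near: n; exact: cs]; rewrite Gz0.
- by have := integrableZl mI (2 * M) iz.
- apply: aeW => s n _; rewrite /= lee_fin /f normr_id.
  apply: le_trans (ler_normB _ _) _; 
  have := Gz_le' z (tau n) s; have := Gz_le' z t s; lra.
move=> _ _; rewrite integral0 => /fine_cvgP[_]; exact.
Unshelve. all: by end_near. Qed.

Let Op_le z t : norm_integrable I z -> `|Op z t| <= M * \int[mu]_(s in I) `|z s|.
Proof.
move=> hz; apply: le_trans (weak_integral_norm mI (Gz_int t hz) (OpP t hz)) _.
have [hzs iz] := hz; rewrite -RintegralZl//; apply: le_Rintegral => //.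
- by have [] := Gz_int t hz.
- by have := integrableZl mI M iz.
Qed.

Let integrable_cst (K : R) : mu.-integrable I (EFin \o cst K).
Proof.
apply: (@continuous_compact_integrable R (cst K)); first exact: segment_compact.
by apply: continuous_subspaceT; exact: cst_continuous.
Qed.

Let Op_int z : norm_integrable I z -> norm_integrable I (Op z).
Proof.
move=> hz; apply: (norm_integrable_le mI (g := cst (M * \int[mu]_(s in I) `|z s|))).
- by apply: seq_continuous_simple_limit => tau t; exact: Op_cvg.
- by move=> s _; exact: Op_le.
exact: integrable_cst.
Qed.

Let Op_lip z z' (E : R) t : norm_integrable I z -> norm_integrable I z' ->
  (forall s, 0 <= s <= T -> `|z s - z' s| <= E * expR (2 * M * s)) ->
  `|Op z t - Op z' t| <= E / 2 * expR (2 * M * c t).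
Proof.
move=> hz hz' zz'; apply: le_trans (OpB t hz hz') _.
have E0 : 0 <= E.
  have := zz' 0; rewrite lexx T0 mulr0 expR0 mulr1 => /(_ isT).
  exact: le_trans.
have /andP[c0 cT] := clamp_itv t T0.
pose e s := expR (2 * M * s).
have ce : continuous (e : R^o -> R^o).
  move=> s; apply: continuous_comp; last exact: continuous_expR.
  by apply: continuousM => //; exact: cst_continuous.
have ie r : mu.-integrable (`[0, r]%classic : set (measurableTypeR R)) (EFin \o e).
  apply: (@continuous_compact_integrable R e); first exact: segment_compact.
  exact: continuous_subspaceT.
have mJ : measurable (`[0, c t]%classic : set (measurableTypeR R)).
  exact: measurable_itv.
apply: (@le_trans _ _ (\int[mu]_(s in `[0, c t]) (M * E * e s))).
  apply: le_Rintegral => //.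
  - have [_ iB] := norm_integrableB mI hz hz'.
    have := integrableZl mI M iB; apply: integrableS => //.
    by apply: subset_itvl; rewrite bnd_simp.
  - by have := integrableZl mJ (M * E) (ie (c t)).
  - move=> s /=; rewrite in_itv/= => /andP[s0 sc].
    by rewrite -mulrA ler_wpM2l ?(ltW M0)// zz'// s0 (le_trans sc).
rewrite RintegralZl//.
have M2 : 0 < 2 * M by rewrite mulr_gt0.
apply: le_trans (ler_wpM2l _ (Rintegral_expR_le M2 c0)) _.
  by rewrite mulr_ge0// ltW.
by rewrite le_eqVlt; apply/orP; left; apply/eqP; field; rewrite gt_eqF.
Qed.

Variable y : R -> X.
Hypothesis hy : norm_integrable I y.

(** The iteration bears on the correction x - y: [y] is merely integrable, while [Op] maps
    integrable functions to bounded continuous ones, for which the weighted supremum norm is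
    finite. *)
Let w n : R -> X := iter n (fun w => Op (fun s => y s + w s)) (fun=> 0).

Let w_int n : norm_integrable I (w n).
Proof.
elim: n => [|n IH]; last by apply: Op_int; exact: norm_integrableD.
apply: (norm_integrable_le mI (g := cst 0)); last exact: integrable_cst.
  by apply: seq_continuous_simple_limit => *; exact: cvg_cst.
by move=> s _; rewrite normr0.
Qed.

Let B := M * \int[mu]_(s in I) `|y s|.

Let B0 : 0 <= B. Proof. by rewrite mulr_ge0 ?(ltW M0)// Rintegral_ge0. Qed.

Let w_increment n t : `|w n.+1 t - w n t| <= B * 2^-1 ^+ n * expR (2 * M * c t).
Proof.
have [c0 cT] := andP (clamp_itv t T0).
elim: n t c0 cT => [|n IH] t c0 cT.
  rewrite subr0 expr0 mulr1; apply: (@le_trans _ _ B).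
    rewrite /w /= (_ : (fun s => _) = y); first exact: Op_le.
    by apply/funext => s; rewrite addr0.
  by rewrite ler_peMr// -[leLHS]expR0 ler_expR !mulr_ge0// ltW.
rewrite exprSr mulrA.
apply: (@Op_lip _ _ (B * 2^-1 ^+ n) t (norm_integrableD mI hy (w_int n.+1))
  (norm_integrableD mI hy (w_int n))).
move=> s sT; rewrite opprD addrACA subrr add0r.
by have := IH s; rewrite clamp_id//; case/andP: sT => s0 sT; apply.
Qed.

(** The 2 compensates the exponent [n.+1] in the hypothesis of [geometric_increments_cvg]. *)
Let K := 2 * B * expR (2 * M * T).

Let K0 : 0 <= K. Proof. by rewrite /K mulr_ge0 ?expR_ge0// mulr_ge0. Qed.

Let expR_c t : 1 <= expR (2 * M * c t) <= expR (2 * M * T).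
Proof.
have /andP[c0 cT] := clamp_itv t T0.
by rewrite -[1]expR0 !ler_expR !mulr_ge0 ?ler_wpM2l ?mulr_ge0// ltW.
Qed.

Let w_limit : exists v : R -> X, forall t n, `|v t - w n t| <= K * 2^-1 ^+ n.
Proof.
suff /choice[v hv] : forall t, exists v, forall n, `|v - w n t| <= K * 2^-1 ^+ n.
  by exists v.
move=> t.
apply: geometric_increments_cvg => n; apply: le_trans (w_increment n t) _.
have /andP[_ ct] := expR_c t.
rewrite /K exprS [leRHS](_ : _ = B * 2^-1 ^+ n * expR (2 * M * T)); last by field.
by rewrite ler_wpM2l// mulr_ge0// exprn_ge0// invr_ge0.
Qed.

Lemma volterra_exists : exists2 x : R -> X, norm_integrable I x &
  forall t, 0 <= t <= T -> forall xi,
    inner (x t) xi = inner (y t) xi + \int[mu]_(s in `[0, t]) inner (G t s (x s)) xi.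
Proof.
have [v vw] := w_limit.
have v_int : norm_integrable I v.
  apply: (norm_integrable_le mI (g := cst K)); last exact: integrable_cst.
    apply: seq_continuous_simple_limit => tau t taut.
    apply/cvgrPdist_lt => e e0.
    have e3 : 0 < e / 3 by rewrite divr_gt0.
    have [n /(_ n (leqnn n)) Kn] := geometric_half_small K e3.
    have cw : w n (tau m) @[m --> \oo] --> w n t.
      case: (n) => [|j]; first exact: cvg_cst.
      by apply: Op_cvg => //; exact: norm_integrableD.
    move/cvgrPdist_lt: cw => /(_ _ e3) cw; near=> m.
    (* Convergence is uniform in [t], so continuity passes from [w n] to [v]. *)
    have -> : v t - v (tau m) =
        (v t - w n t) + (w n t - w n (tau m)) - (v (tau m) - w n (tau m)).
      by rewrite addrA subrK opprB addrA subrK.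
    have h1 := vw t n; have h2 := vw (tau m) n.
    have h3 : `|w n t - w n (tau m)| < e / 3 by near: m; exact: cw.
    apply: le_lt_trans (ler_normB _ _) _.
    have := ler_normD (v t - w n t) (w n t - w n (tau m)); lra.
  by move=> s _; have := vw s 0%N; rewrite subr0 expr0 mulr1.
have yv_int := norm_integrableD mI hy v_int.
(* Both sides are compared with [w n.+1]. The bound on v - w n is unweighted, but the weight is at
   least 1, so [Op_lip] applies with E = K 2^-n. *)
have fixv t : v t = Op (fun s => y s + v s) t.
  apply/eqP; rewrite -subr_eq0 -normr_le0; apply/ler_addgt0Pr => e e0.
  have [n /(_ n (leqnn n)) Kn] :=
    geometric_half_small (K / 2 + K / 2 * expR (2 * M * T)) e0.
  rewrite add0r; apply: le_trans (ltW Kn); apply: le_trans (ler_distD (w n.+1 t) _ _) _.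
  rewrite mulrDl; apply: lerD; first by rewrite -mulrA -exprS.
  have /andP[c1 cT] := expR_c t.
  apply: (@le_trans _ _ (K * 2^-1 ^+ n / 2 * expR (2 * M * c t))).
    apply: Op_lip => //; first exact: norm_integrableD.
    move=> s sT; rewrite opprD addrACA subrr add0r distrC.
    apply: le_trans (vw s n) _; rewrite ler_peMr ?(mulr_ge0 K0) ?exprn_ge0 ?invr_ge0//.
    by have /andP[] := expR_c s; rewrite clamp_id.
  rewrite [leRHS](_ : _ = K * 2^-1 ^+ n / 2 * expR (2 * M * T)); last by field.
  by rewrite ler_wpM2l// divr_ge0// mulr_ge0// exprn_ge0// invr_ge0.
exists (fun s => y s + v s) => // t tT xi.
rewrite innerDl; congr (_ + _); rewrite {1}fixv (OpP t yv_int xi).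
rewrite -(@Rintegral_indic_itv _ T t); last by case/andP: tT.
by apply: eq_Rintegral => s _; rewrite /Gz innerZl clamp_id.
Unshelve. all: by end_near. Qed.
End VolterraExistence.

(** * Gronwall's lemma in L^1 *)

Lemma le_absorb_half (R : realFieldType) (x y z w v : R) :
  x = y + z -> z <= w + v -> v <= 2^-1 * x -> x <= 2 * (y + w).
Proof. lra. Qed.

Section GronwallL1.
Context {R : realType}.
Local Notation mu := (@lebesgue_measure R).
Variables (T M : R) (phi eta : measurableTypeR R -> R).
Local Notation I := (`[0, T]%classic : set (measurableTypeR R)).
Hypotheses (T0 : 0 <= T) (M0 : 0 <= M).
Hypotheses (phi0 : forall t, 0 <= phi t) (eta0 : forall t, 0 <= eta t).
Hypotheses (iphi : mu.-integrable I (EFin \o phi)).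
Hypotheses (ieta : mu.-integrable I (EFin \o eta)).
Hypothesis phi_le : {ae mu, forall t, 0 <= t <= T ->
  phi t <= eta t + M * \int[mu]_(s in `[0, t]) phi s}.

Let integrable_cc (f : measurableTypeR R -> R) b : b <= T ->
  mu.-integrable I (EFin \o f) -> mu.-integrable `[0, b] (EFin \o f).
Proof.
move=> bT; apply: integrableS; [exact: measurable_itv|exact: measurable_itv|].
by apply: subset_itvl; rewrite bnd_simp.
Qed.

Let integrable_oc (f : measurableTypeR R -> R) a b : 0 <= a -> b <= T ->
  mu.-integrable I (EFin \o f) -> mu.-integrable `]a, b] (EFin \o f).
Proof.
move=> a0 bT; apply: integrableS; [exact: measurable_itv|exact: measurable_itv|].
by apply: subset_itv; rewrite bnd_simp.
Qed.

Let split_at (f : measurableTypeR R -> R) (a b : R) : 0 <= a -> a <= b -> b <= T ->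
  mu.-integrable I (EFin \o f) ->
  \int[mu]_(s in `[0, b]) f s = \int[mu]_(s in `[0, a]) f s + \int[mu]_(s in `]a, b]) f s.
Proof.
move=> a0 ab bT fi; rewrite -(@Rintegral_itvB R f (BLeft 0) (BRight b) a) ?bnd_simp//.
  by rewrite addrC subrK.
exact: integrable_cc.
Qed.

Let mono (f : measurableTypeR R -> R) (a b : R) : (forall t, 0 <= f t) ->
  0 <= a -> a <= b -> b <= T -> mu.-integrable I (EFin \o f) ->
  \int[mu]_(s in `[0, a]) f s <= \int[mu]_(s in `[0, b]) f s.
Proof. by move=> f0 a0 ab bT fi; rewrite (split_at a0 ab bT fi) lerDl Rintegral_ge0. Qed.

(** On ]a, b] the inner integral is at most the constant Pb, so integrating the inequality produces
    M (b - a) Pb <= Pb / 2, which the left-hand side absorbs. *)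
Let step (a b : R) : 0 <= a -> a <= b -> b <= T -> M * (b - a) <= 2^-1 ->
  \int[mu]_(s in `[0, b]) phi s <=
    2 * (\int[mu]_(s in `[0, a]) phi s + \int[mu]_(s in `]a, b]) eta s).
Proof.
move=> a0 ab bT Mab; set Pb := \int[mu]_(s in `[0, b]) phi s.
have Pb0 : 0 <= Pb by exact: Rintegral_ge0.
have mJ : measurable (`]a, b]%classic : set (measurableTypeR R)) by exact: measurable_itv.
have iK K : mu.-integrable `]a, b] (EFin \o (cst K : measurableTypeR R -> R)).
  apply: integrable_oc => //.
  apply: (@continuous_compact_integrable R (cst K)); first exact: segment_compact.
  by apply: continuous_subspaceT; exact: cst_continuous.
have h : \int[mu]_(s in `]a, b]) phi s <= \int[mu]_(s in `]a, b]) (eta s + M * Pb).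
  apply: fine_le.
  - by apply: integrable_fin_num => //; exact: integrable_oc.
  - apply: integrable_fin_num => //.
    by have := integrableD mJ (integrable_oc a0 bT ieta) (iK (M * Pb)).
  apply: ae_le_integral_nonmeasurable => [s _|s _|].
  - by rewrite lee_fin.
  - by rewrite lee_fin addr_ge0// mulr_ge0.
  apply: (@filterS _ _ (ae_filter_ringOfSetsType mu) _ _ _ phi_le) => s hs /=.
  rewrite in_itv/= => /andP[as_ sb].
  have s0 : 0 <= s by apply: le_trans (ltW as_).
  rewrite lee_fin (le_trans (hs _)) ?s0 ?(le_trans sb)//.
  by rewrite lerD2l ler_wpM2l// mono.
have e : \int[mu]_(s in `]a, b]) (eta s + M * Pb) =
    \int[mu]_(s in `]a, b]) eta s + M * (b - a) * Pb.
  rewrite (RintegralD mJ (integrable_oc a0 bT ieta) (iK (M * Pb))).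
  congr (_ + _); rewrite Rintegral_cst//.
  rewrite [fine _](_ : _ = b - a); first by ring.
  etransitivity; first exact: (congr1 fine (@lebesgue_measure_itv R `]a, b]%R)).
  rewrite /= lte_fin; have [//|ba] := ltP a b.
  by rewrite (_ : b = a) ?subrr//; apply/eqP; rewrite eq_le ba ab.
apply: (le_absorb_half (split_at a0 ab bT iphi)); first by apply: le_trans h _; rewrite e.
by rewrite ler_wpM2r.
Qed.

(* [N] steps of length [T / N], on each of which [M T / N <= 1 / 2]. *)
Lemma gronwall_L1_steps (N : nat) : (0 < N)%N -> M * T <= N%:R / 2 ->
  \int[mu]_(s in `[0, T]) phi s <= 2 ^+ N * \int[mu]_(s in `[0, T]) eta s.
Proof.
move=> N0 MTN; have Nr : 0 < N%:R :> R by rewrite ltr0n.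
pose r (i : nat) : R := i%:R * (T / N%:R).
have TN : 0 <= T / N%:R by rewrite divr_ge0.
have r0 i : 0 <= r i by rewrite mulr_ge0.
have rS i : r i.+1 - r i = T / N%:R by rewrite /r -addn1 natrD; ring.
have rN : r N = T by rewrite /r mulrCA divff ?mulr1// gt_eqF.
have rT i : (i <= N)%N -> r i <= T by move=> iN; rewrite -rN ler_wpM2r// ler_nat.
have ri i : r i <= r i.+1 by rewrite -subr_ge0 rS.
(* Both integrals run up to the node [r i], and each step doubles the factor. *)
suff h i : (i <= N)%N ->
    \int[mu]_(s in `[0, r i]) phi s <= 2 ^+ i * \int[mu]_(s in `[0, r i]) eta s.
  by have := h N (leqnn N); rewrite rN.
elim: i => [|i IH] iN; first by rewrite /r mul0r set_itv1 !Rintegral_set1 mulr0.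
have MS : M * (r i.+1 - r i) <= 2^-1.
  by rewrite rS mulrA ler_pdivrMr// (mulrC 2^-1).
apply: le_trans (step (r0 i) (ri i) (rT _ iN) MS) _.
rewrite exprS -mulrA ler_wpM2l//.
rewrite (split_at (r0 i) (ri i) (rT _ iN) ieta) mulrDr lerD//; first by exact: IH (ltnW iN).
by rewrite ler_peMl ?Rintegral_ge0// exprn_ege1// ler1n.
Qed.
End GronwallL1.

(** * Extension of the kernels from the triangle to the plane *)

Section KernelExtension.
Context {R : realType}.

(** Composition with a continuous retraction of the plane onto the triangle, which keeps both
    continuity and the bound. *)
Definition kernel_ext (T : R) (k : R -> R -> R) (t s : R) : R :=
  k (clamp T t) (Num.min (clamp T s) (clamp T t)).

Lemma kernel_ext_id T k t s : 0 <= s -> s <= t -> t <= T -> kernel_ext T k t s = k t s.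
Proof.
move=> s0 st tT.
by rewrite /kernel_ext !clamp_id ?min_l// ?s0 ?(le_trans s0)// (le_trans st).
Qed.

Let retract_triangle (T t s : R) : 0 <= T ->
  triangle T (clamp T t, Num.min (clamp T s) (clamp T t)).
Proof.
move=> T0; have /andP[c0 cT] := clamp_itv t T0; have /andP[d0 _] := clamp_itv s T0.
by rewrite /triangle /= le_min c0 d0 ge_min lexx orbT.
Qed.

Lemma kernel_ext_bound (T C : R) k t s : 0 <= T -> volterra_kernel T C k ->
  `|kernel_ext T k t s| <= C.
Proof. by move=> T0 [_ /(_ _ (retract_triangle t s T0))]. Qed.

Let kernel_comp_continuous T C k (f g : R -> R) : volterra_kernel T C k ->
  continuous f -> continuous g -> (forall t, triangle T (f t, g t)) ->
  continuous (fun t => k (f t) (g t)).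
Proof.
move=> [ck _] cf cg fg t.
have /subspace_continuousP/(_ _ (fg t)) h := ck.
have fgt : (f r, g r) @[r --> t] --> within (triangle T) (nbhs (f t, g t)).
  have h2 : (f r, g r) @[r --> t] --> (f t, g t) by exact: (cvg_pair (cf t) (cg t)).
  move=> A hA; have hB := h2 _ hA.
  by apply: (@filterS _ (nbhs t) _ _ _ _ hB) => r; apply; exact: fg.
exact: (cvg_comp _ _ fgt h).
Qed.

Let min_clamp_continuous (T c : R) : continuous (fun t => Num.min c (clamp T t)).
Proof.
apply: (@min_fun_continuous _ R R (cst c) (clamp T)); first exact: cst_continuous.
exact: clamp_continuous.
Qed.

Lemma kernel_ext_continuous1 (T C : R) k s : 0 <= T -> volterra_kernel T C k ->
  continuous (fun t => kernel_ext T k t s).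
Proof.
move=> T0 hk; apply: (kernel_comp_continuous hk) => [||t].
- exact: clamp_continuous.
- exact: min_clamp_continuous.
- exact: retract_triangle.
Qed.

Lemma kernel_ext_continuous2 (T C : R) k t : 0 <= T -> volterra_kernel T C k ->
  continuous (kernel_ext T k t).
Proof.
move=> T0 hk; apply: (kernel_comp_continuous hk (f := cst (clamp T t))
    (g := fun s => Num.min (clamp T s) (clamp T t))) => [||s].
- exact: cst_continuous.
- rewrite (_ : (fun s => _) = fun s => Num.min (clamp T t) (clamp T s)).
    exact: min_clamp_continuous.
  by apply/funext => s; rewrite minC.
- exact: retract_triangle.
Qed.
End KernelExtension.

(** * Regular representatives and the splitting of the data *)

Section RegularRepresentative.
Context {R : realType}.
Local Notation mu := (@lebesgue_measure R).

Lemma aeS (P Q : R -> Prop) : (forall t, P t -> Q t) ->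
  {ae mu, forall t, P t} -> {ae mu, forall t, Q t}.
Proof. exact: (@filterS _ _ (ae_filter_ringOfSetsType mu)). Qed.

Lemma aeI (P Q : R -> Prop) : {ae mu, forall t, P t} -> {ae mu, forall t, Q t} ->
  {ae mu, forall t, P t /\ Q t}.
Proof. exact: (@filterI _ _ (ae_filter_ringOfSetsType mu)). Qed.

Lemma L1norm_ae_eq (B : normedModType R) (T : R) (f g : R -> B) :
  {ae mu, forall t, 0 <= t <= T -> f t = g t} -> L1norm T f = L1norm T g.
Proof.
move=> fg; apply: ae_eq_integral_nonmeasurable.
by apply: aeS fg => t fg; rewrite /= in_itv/= => /fg ->.
Qed.

Lemma L1norm_ae_le (B C : normedModType R) (T : R) (f : R -> B) (g : R -> C) :
  {ae mu, forall t, 0 <= t <= T -> `|f t| <= `|g t|} -> (L1norm T f <= L1norm T g)%E.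
Proof.
move=> fg; apply: ae_le_integral_nonmeasurable.
- by move=> t _; rewrite lee_fin.
- by move=> t _; rewrite lee_fin.
by apply: aeS fg => t fg; rewrite /= in_itv/= lee_fin => /fg.
Qed.

Lemma simple_limit_integrable (B : normedModType R) (T : R) (f : R -> B) :
  simple_limit f -> (L1norm T f < +oo)%E ->
  mu.-integrable `[0, T] (fun t => `|f t|%:E).
Proof.
move=> hf Lf; apply/integrableP; split.
  by apply/measurable_EFinP; apply: measurable_funTS; exact: simple_limit_norm.
by move: Lf; under [in X in _ -> X]eq_integral do rewrite abse_EFin normr_id.
Qed.

Lemma L1normE (B : normedModType R) (T : R) (f : R -> B) :
  mu.-integrable `[0, T] (fun t => `|f t|%:E) ->
  L1norm T f = (\int[mu]_(t in `[0, T]) `|f t|)%:E.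
Proof.
by move=> fi; rewrite /Rintegral fineK//; apply: integrable_fin_num.
Qed.

Lemma regular_representative (B : normedModType R) (T : R) (f : R -> B) :
  inL1 T f -> exists f', [/\ simple_limit f',
    {ae mu, forall t, 0 <= t <= T -> f' t = f t} &
    mu.-integrable `[0, T] (fun t => `|f' t|%:E)].
Proof.
move=> [/strongly_measurable_simple_limit[f' hf' ff'] Lf]; exists f'; split=> //.
by apply: simple_limit_integrable => //; rewrite (L1norm_ae_eq ff').
Qed.
End RegularRepresentative.

Lemma dual_part_linear (R : realType) (V : hilbertType R) (K : csubspace V) :
  linear (dual_part K).
Proof. by move=> k phi psi; apply: dualP. Qed.

Lemma dual_part_norm (R : realType) (V : hilbertType R) (K : csubspace V)
  (phi : topdual V) : `|dual_part K phi| <= `|phi|.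
Proof.
apply: dual_norm_le => v v1.
exact: (@dual_norm_unit _ _ phi _ (le_trans (proj_norm K v) v1)).
Qed.

Lemma dual_part_continuous (R : realType) (V : hilbertType R) (K : csubspace V) :
  continuous (dual_part K).
Proof.
pose L : {linear topdual V -> topdual V} :=
  HB.pack (dual_part K) (GRing.isLinear.Build R _ _ _ (dual_part K) (dual_part_linear K)).
apply: (@linear_norm_le_continuous _ _ _ L 1) => phi; rewrite mul1r.
exact: dual_part_norm.
Qed.

Lemma dual_part_orthc (R : realType) (V : hilbertType R) (K : csubspace V)
  (phi : topdual V) : phi = dual_part (orthc K) phi + dual_part K phi.
Proof.
by apply: dualP => v; rewrite {1}[v in phi v](proj_orthc K) linearD/= addrC.
Qed.

(** Adding the two integrals requires measurable integrands, hence the passage to a representative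
    whose parts have Borel norms. *)
Lemma L1norm_dual_part (R : realType) (V : hilbertType R) (K : csubspace V) (T : R)
    (f : R -> topdual V) : inL1 T f ->
  (L1norm T f <= L1norm T (fun t => dual_part (orthc K) (f t)) +
                 L1norm T (fun t => dual_part K (f t)))%E.
Proof.
move=> /regular_representative[f' [hf' ff' _]].
rewrite -(L1norm_ae_eq ff').
have part K' : L1norm T (fun t => dual_part K' (f t)) =
    L1norm T (fun t => dual_part K' (f' t)).
  by apply: L1norm_ae_eq; apply: aeS ff' => t h /h ->.
have mpart K' : measurable_fun `[0, T]
    (fun t : measurableTypeR R => `|dual_part K' (f' t)|%:E).
  apply/measurable_EFinP; apply: measurable_funTS; apply: simple_limit_norm.
  by apply: (simple_limit_comp hf'); exact: dual_part_continuous.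
rewrite !part -ge0_integralD//=; try by move=> t _; rewrite lee_fin.
apply: ae_le_integral_nonmeasurable.
- by move=> t _; rewrite lee_fin.
- by move=> t _; rewrite -EFinD lee_fin addr_ge0.
- apply: aeW => t _; rewrite -EFinD lee_fin {1}(dual_part_orthc K (f' t)).
  exact: ler_normD.
- exact: mpart.
- exact: mpart.
Qed.
(** Compatibility with differences is asked in place of a linear structure, which would have to be
    declared for each map concerned. *)
Lemma additive_bounded_continuous (R : realType) (U W : normedModType R)
    (f : U -> W) (M : R) : (forall x y, f (x - y) = f x - f y) ->
  (forall x, `|f x| <= M * `|x|) -> continuous f.
Proof.
move=> fB fM x; apply/cvgrPdist_le => e e0.
have M1 : 0 < `|M| + 1 by rewrite ltr_wpDl.
have eM : 0 < e / (`|M| + 1) by rewrite divr_gt0.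
near=> y; rewrite -fB; apply: le_trans (fM _) _.
have h : `|x - y| <= e / (`|M| + 1) by near: y; exact: cvgr_dist_le.
apply: (@le_trans _ _ ((`|M| + 1) * (e / (`|M| + 1)))); last by rewrite mulrC divfK// gt_eqF.
apply: le_trans (ler_wpM2r (normr_ge0 _) (ler_norm M)) _.
by apply: ler_pM => //; rewrite lerDl.
Unshelve. all: by end_near. Qed.

(** * Reduction of the system to a Volterra equation *)

Section SaddleVolterra.
Context {R : realType} {V Q : hilbertType R}.
Local Notation X := (hprod V Q).
Local Notation mu := (@lebesgue_measure R).
Variables (T : R) (a : cbilinear V V) (b : cbilinear V Q) (c : cbilinear Q Q).
Variables (k1 k2 k3 k4 : R -> R -> R) (Ck1 Ck2 Ck3 Ck4 : R).
Variables (S : {linear X -> X}) (Cs : R).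
Hypotheses (T0 : 0 <= T) (Cs0 : 0 <= Cs).
Hypotheses (hk1 : volterra_kernel T Ck1 k1) (hk2 : volterra_kernel T Ck2 k2).
Hypotheses (hk3 : volterra_kernel T Ck3 k3) (hk4 : volterra_kernel T Ck4 k4).
Hypothesis SK : cancel S (saddle_op a b c).
Hypothesis Snorm : forall z, `|S z| <= Cs * `|z|.
Hypothesis op_sym :
  forall x y, inner (saddle_op a b c x) y = inner x (saddle_op a b c y).
Local Notation I := (`[0, T]%classic : set (measurableTypeR R)).
Local Notation A := (saddle_op a b c).

Let mI : measurable I. Proof. exact: measurable_itv. Qed.

(* [S] applied to the integrand of the system. As [S (b u, ...)] equals
   [(u, 0) - S (a u, 0)], and similarly for [b^* p], the norm of [b] does not
   enter the bound below. *)
Let Pu (x : X) : X := (x.1, 0).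
Let Pp (x : X) : X := (0, x.2).
Let Sa (x : X) : X := S (riesz (opB a x.1), 0).
Let Sc (x : X) : X := S (0, riesz (opB c x.2)).

Definition reduced_kernel (t s : R) (x : X) : X :=
  kernel_ext T k3 t s *: Pu x + kernel_ext T k2 t s *: Pp x +
  (kernel_ext T k1 t s - kernel_ext T k3 t s) *: Sa x +
  (kernel_ext T k2 t s - kernel_ext T k4 t s) *: Sc x.

Local Notation G := reduced_kernel.

(** The final 1 keeps the bound positive even for vanishing kernels, as the exponential weight of
    the Picard iteration requires. *)
Definition reduced_bound : R :=
  Ck3 + Ck2 + (Ck1 + Ck3) * (Cs * bilinear_norm a)
  + (Ck2 + Ck4) * (Cs * bilinear_norm c) + 1.

Let Ck_ge0 C k : volterra_kernel T C k -> 0 <= C.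
Proof. by move=> hk; apply: le_trans (kernel_ext_bound 0 0 T0 hk). Qed.

Lemma reduced_bound_gt0 : 0 < reduced_bound.
Proof.
have h1 := Ck_ge0 hk1; have h2 := Ck_ge0 hk2; have h3 := Ck_ge0 hk3; have h4 := Ck_ge0 hk4.
by rewrite ltr_wpDl// !addr_ge0// !mulr_ge0 ?addr_ge0 ?bilinear_norm_ge0.
Qed.

Let riesz_opB (W : hilbertType R) (d : cbilinear W W) w :
  `|riesz (opB d w)| <= bilinear_norm d * `|w|.
Proof.
apply: le_trans (riesz_norm _) _; apply: dual_norm_le => v v1 /=.
apply: le_trans (bilinear_norm_ub _ _ _) _.
by rewrite ler_piMr// mulr_ge0// bilinear_norm_ge0.
Qed.

Let inl_norm (u : V) : `|((u, 0) : X)| <= `|u|.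
Proof. by apply: le_trans (hprod_norm_le _) _; rewrite /= normr0 addr0. Qed.

Let inr_norm (p : Q) : `|((0, p) : X)| <= `|p|.
Proof. by apply: le_trans (hprod_norm_le _) _; rewrite /= normr0 add0r. Qed.

Let Pu_norm x : `|Pu x| <= 1 * `|x|.
Proof. by rewrite mul1r; exact: le_trans (inl_norm _) (hprod_norm1 x). Qed.

Let Pp_norm x : `|Pp x| <= 1 * `|x|.
Proof. by rewrite mul1r; exact: le_trans (inr_norm _) (hprod_norm2 x). Qed.

Let Sa_norm x : `|Sa x| <= Cs * bilinear_norm a * `|x|.
Proof.
apply: le_trans (Snorm _) _; rewrite -mulrA ler_wpM2l//.
apply: le_trans (inl_norm _) _; apply: le_trans (riesz_opB _ _) _.
by rewrite ler_wpM2l ?bilinear_norm_ge0 ?hprod_norm1.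
Qed.

Let Sc_norm x : `|Sc x| <= Cs * bilinear_norm c * `|x|.
Proof.
apply: le_trans (Snorm _) _; rewrite -mulrA ler_wpM2l//.
apply: le_trans (inr_norm _) _; apply: le_trans (riesz_opB _ _) _.
by rewrite ler_wpM2l ?bilinear_norm_ge0 ?hprod_norm2.
Qed.

Let PuB x y : Pu (x - y) = Pu x - Pu y.
Proof. by apply/pair_equal_spec; rewrite /= subr0. Qed.

Let PpB x y : Pp (x - y) = Pp x - Pp y.
Proof. by apply/pair_equal_spec; rewrite /= subr0. Qed.

Let SaB x y : Sa (x - y) = Sa x - Sa y.
Proof.
by rewrite /Sa -linearB; congr (S _); apply/pair_equal_spec; rewrite /= subr0 !linearB.
Qed.

Let ScB x y : Sc (x - y) = Sc x - Sc y.
Proof.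
by rewrite /Sc -linearB; congr (S _); apply/pair_equal_spec; rewrite /= subr0 !linearB.
Qed.

Lemma reduced_kernel_norm t s x : `|G t s x| <= reduced_bound * `|x|.
Proof.
have h1 := Ck_ge0 hk1; have h2 := Ck_ge0 hk2; have h3 := Ck_ge0 hk3; have h4 := Ck_ge0 hk4.
have b1 := kernel_ext_bound t s T0 hk1; have b2 := kernel_ext_bound t s T0 hk2.
have b3 := kernel_ext_bound t s T0 hk3; have b4 := kernel_ext_bound t s T0 hk4.
have term (k C D : R) (z : X) : `|k| <= C -> `|z| <= D * `|x| -> `|k *: z| <= C * D * `|x|.
  by move=> kC zD; rewrite normrZ -mulrA ler_pM.
apply: (@le_trans _ _ ((Ck3 * 1 + Ck2 * 1 + (Ck1 + Ck3) * (Cs * bilinear_norm a)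
  + (Ck2 + Ck4) * (Cs * bilinear_norm c)) * `|x|)); last first.
  by rewrite /reduced_bound !mulr1 ler_wpM2r// lerDl.
rewrite [leRHS]mulrDl; apply: le_trans (ler_normD _ _) _; apply: lerD; last first.
  by apply: term => //; apply: le_trans (ler_normB _ _) _; exact: lerD.
rewrite [leRHS]mulrDl; apply: le_trans (ler_normD _ _) _; apply: lerD; last first.
  by apply: term => //; apply: le_trans (ler_normB _ _) _; exact: lerD.
rewrite [leRHS]mulrDl; apply: le_trans (ler_normD _ _) _.
by apply: lerD; exact: term.
Qed.

Lemma reduced_kernelB t s x y : G t s (x - y) = G t s x - G t s y.
Proof.
rewrite /reduced_kernel PuB PpB SaB ScB !scalerBr !opprD.
by rewrite [RHS]addrACA; congr (_ + _); rewrite [RHS]addrACA; congr (_ + _);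
  rewrite [RHS]addrACA.
Qed.

(** Since A (u, 0) = (a u, b u) and A (0, p) = (b^* p, - c p), applying [A] to the kernel cancels
    the terms k3 a and k2 c brought in by [Pu] and [Pp] against those of [Sa] and [Sc]. *)
Lemma saddle_form_reduced_kernel t s x (y : X) : 0 <= s -> s <= t -> t <= T ->
  saddle_form a b c (G t s x) y =
  k1 t s * a x.1 y.1 + k2 t s * b y.1 x.2 +
  (k3 t s * b x.1 y.2 - k4 t s * c x.2 y.2).
Proof.
move=> s0 st tT; rewrite -saddle_opE /reduced_kernel /Pu /Pp /Sa /Sc !kernel_ext_id//.
rewrite !linearD/= !linearZ/= !SK !innerDl !innerZl !saddle_opE /saddle_form/=.
rewrite !hprod_innerE/= !rieszE !inner0l !linear0l !linear0r/=.
rewrite /GRing.scale/=; ring.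
Qed.

Lemma reduced_kernel_continuous1 s x : continuous (fun t => G t s x).
Proof.
move=> t.
have c1 := @kernel_ext_continuous1 R T _ _ s T0 hk1 t.
have c2 := @kernel_ext_continuous1 R T _ _ s T0 hk2 t.
have c3 := @kernel_ext_continuous1 R T _ _ s T0 hk3 t.
have c4 := @kernel_ext_continuous1 R T _ _ s T0 hk4 t.
exact: (cvgD (cvgD (cvgD (cvgZr_tmp c3) (cvgZr_tmp c2)) (cvgZr_tmp (cvgB c1 c3)))
  (cvgZr_tmp (cvgB c2 c4))).
Qed.

Lemma reduced_kernel_continuous2 t : continuous (fun v : R^o * X => G t v.1 v.2).
Proof.
move=> v.
have kc C k : volterra_kernel T C k ->
    kernel_ext T k t w.1 @[w --> v] --> kernel_ext T k t v.1.
  move=> hk; apply: (@continuous_comp _ _ _ (fun w : R^o * X => w.1) (kernel_ext T k t)).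
    exact: cvg_fst.
  exact: (@kernel_ext_continuous2 R T _ _ t T0 hk).
have fc (f : X -> X) M : (forall x y, f (x - y) = f x - f y) ->
    (forall x, `|f x| <= M * `|x|) -> f w.2 @[w --> v] --> f v.2.
  move=> fB fM; apply: (@continuous_comp _ _ _ (fun w : R^o * X => w.2) f).
    exact: cvg_snd.
  exact: additive_bounded_continuous fB fM v.2.
have cPu := fc _ _ PuB Pu_norm; have cPp := fc _ _ PpB Pp_norm.
have cSa := fc _ _ SaB Sa_norm; have cSc := fc _ _ ScB Sc_norm.
have c1 := kc _ _ hk1; have c2 := kc _ _ hk2; have c3 := kc _ _ hk3; have c4 := kc _ _ hk4.
exact: (cvgD (cvgD (cvgD (cvgZ c3 cPu) (cvgZ c2 cPp)) (cvgZ (cvgB c1 c3) cSa))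
  (cvgZ (cvgB c2 c4) cSc)).
Qed.

Definition system_at (f : topdual V) (g : topdual Q) (x : R -> X) (t : R) :=
  forall (v : V) (q : Q),
     a (x t).1 v + b v (x t).2 = f v
       + \int[mu]_(s in `[0, t]) (k1 t s * a (x s).1 v + k2 t s * b v (x s).2) /\
     b (x t).1 q - c (x t).2 q = g q
       + \int[mu]_(s in `[0, t]) (k3 t s * b (x s).1 q - k4 t s * c (x s).2 q).

Let sub_itv t : t <= T -> `[0, t]%classic `<=` `[0, T]%classic.
Proof. by move=> tT; apply: subset_itvl; rewrite bnd_simp. Qed.

Lemma norm_integrable_sub (x : R -> X) t : t <= T ->
  norm_integrable I x -> norm_integrable `[0, t] x.
Proof.
move=> tT [hx ix]; split=> //; apply: integrableS ix; [exact: measurable_itv..|].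
exact: sub_itv.
Qed.

Lemma reduced_kernel_integrable (x : R -> X) t : t <= T ->
  norm_integrable I x -> norm_integrable `[0, t] (fun s => G t s (x s)).
Proof.
move=> tT /(norm_integrable_sub tT)[hx ix].
have mJ : measurable (`[0, t]%classic : set (measurableTypeR R)) by exact: measurable_itv.
apply: (norm_integrable_le mJ (g := fun s => reduced_bound * `|x s|)).
- have hid : simple_limit (id : R -> R) by exact/measurable_simple_limit/measurable_id.
  exact: (simple_limit_comp (simple_limit_pair hid hx) (@reduced_kernel_continuous2 t)).
- by move=> s _; exact: reduced_kernel_norm.
by have := integrableZl mJ reduced_bound ix.
Qed.

(* Both directions test with [A zeta], which is an arbitrary vector. *)
Lemma system_at_weak_integral (f : topdual V) (g : topdual Q) (x : R -> X) t :
  norm_integrable I x -> 0 <= t <= T ->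
  system_at f g x t <->
  is_weak_integral `[0, t] (fun s => G t s (x s)) (x t - S (riesz f, riesz g)).
Proof.
move=> ix /andP[t0 tT].
have iG := reduced_kernel_integrable tT ix.
have lhs (z : X) : inner (x t - S (riesz f, riesz g)) (A z) =
    saddle_form a b c (x t) z - (f z.1 + g z.2).
  by rewrite -op_sym linearB/= SK innerBl saddle_opE hprod_innerE !rieszE.
have rhs (z : X) : \int[mu]_(s in `[0, t]) inner (G t s (x s)) (A z) =
    \int[mu]_(s in `[0, t]) (k1 t s * a (x s).1 z.1 + k2 t s * b z.1 (x s).2 +
      (k3 t s * b (x s).1 z.2 - k4 t s * c (x s).2 z.2)).
  apply: eq_Rintegral => s; rewrite inE/= in_itv/= => /andP[s0 st].
  by rewrite -op_sym saddle_opE saddle_form_reduced_kernel.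
have rhs1 v : \int[mu]_(s in `[0, t]) inner (G t s (x s)) (A (v, 0)) =
    \int[mu]_(s in `[0, t]) (k1 t s * a (x s).1 v + k2 t s * b v (x s).2).
  by rewrite rhs; apply: eq_Rintegral => s _; rewrite /= !linear0r ?mulr0 subrr addr0.
have rhs2 q : \int[mu]_(s in `[0, t]) inner (G t s (x s)) (A (0, q)) =
    \int[mu]_(s in `[0, t]) (k3 t s * b (x s).1 q - k4 t s * c (x s).2 q).
  rewrite rhs; apply: eq_Rintegral => s _.
  by rewrite /= linear0r ?linear0l ?mulr0 !add0r.
have lhs1 v : inner (x t - S (riesz f, riesz g)) (A (v, 0)) =
    a (x t).1 v + b v (x t).2 - f v.
  by rewrite lhs /saddle_form/= !linear0r !linear0 !addr0.
have lhs2 q : inner (x t - S (riesz f, riesz g)) (A (0, q)) =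
    b (x t).1 q - c (x t).2 q - g q.
  by rewrite lhs /saddle_form/= linear0r linear0l !linear0 !add0r.
split=> [sys xi|weak v q]; last first.
  split; first by rewrite -rhs1 -weak lhs1 [RHS]addrC subrK.
  by rewrite -rhs2 -weak lhs2 [RHS]addrC subrK.
rewrite -(SK xi); case: (S xi) => v q.
have -> : ((v, q) : X) = (v, 0) + (0, q).
  by apply/pair_equal_spec; rewrite /= addr0 add0r.
have [sys1 sys2] := sys v q.
rewrite linearD innerDr lhs1 lhs2 sys1 sys2.
under [RHS]eq_Rintegral do rewrite innerDr.
rewrite RintegralD; [|exact: measurable_itv|exact: inner_integrable..].
by rewrite rhs1 rhs2 (addrC (f v)) (addrC (g q)) !addrK.
Qed.

Lemma reduced_a_priori (x y : R -> X) (N : nat) :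
  norm_integrable I x -> norm_integrable I y ->
  {ae mu, forall t, 0 <= t <= T ->
    is_weak_integral `[0, t] (fun s => G t s (x s)) (x t - y t)} ->
  (0 < N)%N -> reduced_bound * T <= N%:R / 2 ->
  \int[mu]_(t in I) `|x t| <= 2 ^+ N * \int[mu]_(t in I) `|y t|.
Proof.
move=> ix iy weak N0 MN; have [hx jx] := ix; have [hy jy] := iy.
have M0 := ltW reduced_bound_gt0.
apply: (@gronwall_L1_steps R T reduced_bound (fun t => `|x t|) (fun t => `|y t|)) => //.
apply: aeS weak => t weak t0T; have /andP[t0 tT] := t0T.
have mJ : measurable (`[0, t]%classic : set (measurableTypeR R)) by exact: measurable_itv.
rewrite -{1}(subrK (y t) (x t)) addrC; apply: le_trans (ler_normD _ _) _; rewrite lerD2l.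
have iG := reduced_kernel_integrable tT ix.
apply: le_trans (weak_integral_norm mJ iG (weak t0T)) _.
have [_ jG] := iG; have [_ jxt] := norm_integrable_sub tT ix.
rewrite -RintegralZl//; apply: le_Rintegral => //.
  by have := integrableZl mJ reduced_bound jxt.
by move=> s _; exact: reduced_kernel_norm.
Qed.

(** The difference solves the equation with datum 0, so the a priori bound makes the integral of its
    norm vanish. *)
Lemma reduced_unique (x x' y : R -> X) :
  norm_integrable I x -> norm_integrable I x' ->
  {ae mu, forall t, 0 <= t <= T ->
    is_weak_integral `[0, t] (fun s => G t s (x s)) (x t - y t)} ->
  {ae mu, forall t, 0 <= t <= T ->
    is_weak_integral `[0, t] (fun s => G t s (x' s)) (x' t - y t)} ->
  {ae mu, forall t, 0 <= t <= T -> x' t = x t}.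
Proof.
move=> ix ix' weak weak'.
have id := norm_integrableB mI ix ix'.
have i0 : norm_integrable I (fun=> 0 : X).
  apply: (norm_integrable_le mI (g := cst 0)).
  - by apply: seq_continuous_simple_limit => *; exact: cvg_cst.
  - by move=> s _; rewrite normr0.
  - exact: integrable0.
have weakd : {ae mu, forall t, 0 <= t <= T ->
    is_weak_integral `[0, t] (fun s => G t s (x s - x' s)) (x t - x' t - 0)}.
  apply: aeS (aeI weak weak') => t [w w'] t0T; have /andP[t0 tT] := t0T.
  have mJ : measurable (`[0, t]%classic : set (measurableTypeR R)).
    exact: measurable_itv.
  have := weak_integralB mJ (reduced_kernel_integrable tT ix)
    (reduced_kernel_integrable tT ix') (w t0T) (w' t0T).
  rewrite opprB addrA subrK subr0 => h xi; rewrite h.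
  by apply: eq_Rintegral => s _; rewrite reduced_kernelB.
(* The Archimedean bound gives 2 M T <= N, and the successor makes the number of steps positive. *)
pose N := (Num.bound (reduced_bound * T * 2)).+1.
have MN : reduced_bound * T <= N%:R / 2.
  have MT : 0 <= reduced_bound * T * 2.
    by rewrite !mulr_ge0// ltW// reduced_bound_gt0.
  rewrite ler_pdivlMr//; apply: le_trans (ltW (archi_boundP MT)) _.
  by rewrite ler_nat.
have := reduced_a_priori id i0 weakd (ltn0Sn _) MN.
rewrite [X in _ * X](_ : _ = 0) ?mulr0; last first.
  rewrite (@eq_Rintegral _ _ _ mu I (cst 0)) ?Rintegral_cst ?mul0r//.
  by move=> t _ /=; rewrite normr0.
move=> d0.
have [hd jd] := id.
have e0 : (\int[mu]_(t in I) `|(`|x t - x' t|)%:E| = 0)%E.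
  under eq_integral do rewrite abse_EFin normr_id.
  rewrite -[LHS]fineK; last exact: integrable_fin_num.
  by congr (_%:E); apply/eqP; rewrite eq_le d0 /=; exact: Rintegral_ge0.
have md : measurable_fun I (fun t => (`|x t - x' t|)%:E) by have /integrableP[] := jd.
have /(ae_eq_integral_abs mu mI md) := e0.
apply: aeS => t /= h t0T; have := h; rewrite in_itv/= t0T => /(_ isT)[] /eqP.
by rewrite normr_eq0 subr_eq0 => /eqP.
Qed.

Lemma reduced_exists (y : R -> X) : norm_integrable I y ->
  exists2 x, norm_integrable I x & forall t, 0 <= t <= T ->
    is_weak_integral `[0, t] (fun s => G t s (x s)) (x t - y t).
Proof.
move=> iy.
have [x ix xE] := volterra_exists T0 reduced_bound_gt0 reduced_kernel_continuous1
  reduced_kernel_continuous2 reduced_kernelB reduced_kernel_norm iy.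
by exists x => // t t0T xi; rewrite innerBl xE// addrC addKr.
Qed.

Lemma data_representative (f : R -> topdual V) (g : R -> topdual Q) :
  inL1 T f -> inL1 T g -> exists y, [/\ norm_integrable I y,
    {ae mu, forall t, 0 <= t <= T -> y t = S (riesz (f t), riesz (g t))} &
    ((\int[mu]_(t in I) `|y t|)%:E <= Cs%:E * (L1norm T f + L1norm T g))%E].
Proof.
move=> /regular_representative[f' [hf ff' jf]] /regular_representative[g' [hg gg' jg]].
pose L (z : topdual V * topdual Q) : X := S (riesz z.1, riesz z.2).
have Lz z : `|L z| <= Cs * (`|z.1| + `|z.2|).
  apply: le_trans (Snorm _) _; rewrite ler_wpM2l//.
  by apply: le_trans (hprod_norm_le _) _; rewrite lerD//; exact: riesz_norm.
have jfg : mu.-integrable I (EFin \o (fun t => Cs * (`|f' t| + `|g' t|))).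
  by have := integrableZl mI Cs (integrableD mI jf jg).
have iy : norm_integrable I (fun t => L (f' t, g' t)).
  apply: (norm_integrable_le mI (g := fun t => Cs * (`|f' t| + `|g' t|))) => //.
    apply: (simple_limit_comp (simple_limit_pair hf hg)).
    (* The 2 bounds |z.1| + |z.2| by the maximum norm; it serves continuity only and does not enter
       the estimate of [y]. *)
    apply: (@additive_bounded_continuous _ _ _ L (Cs * 2)) => [z w|z].
      rewrite /L -linearB; congr (S _).
      by apply/pair_equal_spec; rewrite /= !linearB.
    apply: le_trans (Lz z) _; rewrite -mulrA ler_wpM2l// mulr2n mulrDl !mul1r.
    by apply: lerD; rewrite /Num.norm/= le_max lexx ?orbT.
exists (fun t => L (f' t, g' t)); split=> //.
  by apply: aeS (aeI ff' gg') => t [h1 h2] tT; rewrite /L /= h1// h2.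
rewrite -(L1norm_ae_eq ff') -(L1norm_ae_eq gg') !L1normE// -EFinD -EFinM lee_fin.
rewrite -RintegralD// -RintegralZl//; last by have := integrableD mI jf jg.
by apply: le_Rintegral => //; have [] := iy.
Qed.

Lemma solution_representative (f : R -> topdual V) (g : R -> topdual Q)
    (u : R -> V) (p : R -> Q) :
  volterra_solution T a b c k1 k2 k3 k4 f g u p ->
  exists x : R -> X, [/\ norm_integrable I x,
    {ae mu, forall t, 0 <= t <= T -> x t = (u t, p t)} &
    {ae mu, forall t, 0 <= t <= T -> system_at (f t) (g t) x t}].
Proof.
move=> [/regular_representative[z [hz zup jz]] sys].
(* The identity, seen as a map from the maximum norm to the Euclidean norm. *)
pose L (w : V * Q) : X := w.
have Lw w : `|L w| <= 2 * `|w|.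
  apply: le_trans (hprod_norm_le _) _; rewrite mulr2n mulrDl !mul1r.
  by apply: lerD; rewrite [leRHS]/Num.norm/= le_max lexx ?orbT.
have ix : norm_integrable I (fun t => L (z t)).
  apply: (norm_integrable_le mI (g := fun t => 2 * `|z t|)).
  - by apply: (simple_limit_comp hz); exact: (@additive_bounded_continuous _ _ _ L 2).
  - by move=> t _; exact: Lw.
  by have := integrableZl mI 2 jz.
have xup : {ae mu, forall t, 0 <= t <= T -> L (z t) = (u t, p t)} by [].
exists (fun t => L (z t)); split=> //.
apply: aeS (aeI xup sys) => t [xt syst] t0T v q; have /andP[t0 tT] := t0T.
have [sys1 sys2] := syst t0T v q; rewrite xt//=.
(* The null set of [s] where the representative differs is the same for every [t], so the integrals
   agree at each [t]. *)
split; [rewrite sys1|rewrite sys2]; congr (_ + _); apply: ae_eq_Rintegral.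
  apply: aeS xup => s h; rewrite /= in_itv/= => /andP[s0 st].
  by rewrite h ?s0 ?(le_trans st).
apply: aeS xup => s h; rewrite /= in_itv/= => /andP[s0 st].
by rewrite h ?s0 ?(le_trans st).
Qed.
End SaddleVolterra.
(* [M] is the bound of [reduced_kernel] and [N] the number of steps in Gronwall's
   lemma; the leading 2 comes from [|u| + |p| <= 2 |(u, p)|]. *)
Definition volterra_const (R : realType) (al be ga A Cc C1 C2 C3 C4 T : R) : R :=
  let Cs := stability_const al be ga A Cc in
  let M := C3 + C2 + (C1 + C3) * (Cs * A) + (C2 + C4) * (Cs * Cc) + 1 in
  let N := (Num.bound (M * T * 2)).+1 in
  2 * (2 ^+ N * Cs).

Theorem theorem2p4 (R : realType) :
  (* C depends only on alpha0, beta, gamma0, |a|, |c|, Ck1, ..., Ck4 and T *)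
  exists C : R -> R -> R -> R -> R -> R -> R -> R -> R -> R -> R,
  forall (V Q : hilbertType R) (T : R)
    (a : cbilinear V V) (b : cbilinear V Q) (c : cbilinear Q Q)
    (alpha0 beta gamma0 : R)
    (k1 k2 k3 k4 : R -> R -> R) (Ck1 Ck2 Ck3 Ck4 : R),
  let K := kerB b in
  let H := kerBt b in
  let Cst := C alpha0 beta gamma0 (bilinear_norm a) (bilinear_norm c)
               Ck1 Ck2 Ck3 Ck4 T in
  0 <= T ->
  (forall v w, a v w = a w v) -> (forall v, 0 <= a v v) ->
  (forall p q, c p q = c q p) -> (forall q, 0 <= c q q) ->
  0 < alpha0 -> (forall v, cs_set K v -> alpha0 * `|v| ^+ 2 <= a v v) ->
  0 < gamma0 -> (forall q, cs_set H q -> gamma0 * `|q| ^+ 2 <= c q q) ->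
  volterra_kernel T Ck1 k1 -> volterra_kernel T Ck2 k2 ->
  volterra_kernel T Ck3 k3 -> volterra_kernel T Ck4 k4 ->
  closed (range (opB b)) ->
  0 < beta ->
  (forall q, cs_set (orthc H) q ->
     beta * `|q| <= sup [set b v q / `|v| | v in [set v | v != 0]]) ->
  (forall v, cs_set (orthc K) v ->
     beta * `|v| <= sup [set b v q / `|q| | q in [set q | q != 0]]) ->
  0 < Cst /\
  (forall (f : R -> topdual V) (g : R -> topdual Q), inL1 T f -> inL1 T g ->
     exists (u : R -> V) (p : R -> Q),
     [/\ volterra_solution T a b c k1 k2 k3 k4 f g u p,
         forall (u' : R -> V) (p' : R -> Q),
           volterra_solution T a b c k1 k2 k3 k4 f g u' p' ->
           {ae @lebesgue_measure R, forall t, 0 <= t <= T ->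
              u' t = u t /\ p' t = p t} &
         (L1norm T u + L1norm T p <= Cst%:E * (L1norm T f + L1norm T g))%E]) /\
  exists C_ : nat -> R, (forall i, (1 <= i <= 16)%N -> 0 < C_ i) /\
  forall (f : R -> topdual V) (g : R -> topdual Q), inL1 T f -> inL1 T g ->
  forall (u : R -> V) (p : R -> Q),
  volterra_solution T a b c k1 k2 k3 k4 f g u p ->
  let ub := fun t => orth_proj (orthc K) (u t) in
  let u0 := fun t => orth_proj K (u t) in
  let pb := fun t => orth_proj (orthc H) (p t) in
  let p0 := fun t => orth_proj H (p t) in
  let fb := fun t => dual_part (orthc K) (f t) in
  let f0 := fun t => dual_part K (f t) in
  let gb := fun t => dual_part (orthc H) (g t) in
  let g0 := fun t => dual_part H (g t) in
  [/\ (L1norm T ub <=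
         (C_ 9%N)%:E * L1norm T fb + (C_ 13%N)%:E * L1norm T f0
         + (C_ 3%N)%:E * L1norm T gb + (C_ 7%N)%:E * L1norm T g0)%E,
      (L1norm T u0 <=
         (C_ 10%N)%:E * L1norm T fb + (C_ 14%N)%:E * L1norm T f0
         + (C_ 4%N)%:E * L1norm T gb + (C_ 8%N)%:E * L1norm T g0)%E,
      (L1norm T pb <=
         (C_ 11%N)%:E * L1norm T fb + (C_ 15%N)%:E * L1norm T f0
         + (C_ 1%N)%:E * L1norm T gb + (C_ 5%N)%:E * L1norm T g0)%E &
      (L1norm T p0 <=
         (C_ 12%N)%:E * L1norm T fb + (C_ 16%N)%:E * L1norm T f0
         + (C_ 2%N)%:E * L1norm T gb + (C_ 6%N)%:E * L1norm T g0)%E].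
Proof.
exists (@volterra_const R) => V Q T a b c al be ga k1 k2 k3 k4 C1 C2 C3 C4 K H Cst.
move=> T0 asym a0 csym c0 al0 acoer ga0 ccoer hk1 hk2 hk3 hk4 _ be0 infQ infV.
pose Cs := stability_const al be ga (bilinear_norm a) (bilinear_norm c).
have Cs0 : 0 < Cs by apply: stability_const_gt0; rewrite ?bilinear_norm_ge0.
have Cst0 : 0 < Cst by apply: mulr_gt0 => //; apply: mulr_gt0 => //; rewrite exprn_gt0.
have [S [SK _ Sn]] := saddle_inverse asym a0 csym c0 al0 be0 ga0 acoer ccoer infQ infV.
have op_sym := saddle_op_sym b asym csym.
pose G := reduced_kernel T a c k1 k2 k3 k4 S.
pose M := reduced_bound a c C1 C2 C3 C4 Cs.
pose N := (Num.bound (M * T * 2)).+1.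
have MN : M * T <= N%:R / 2.
  have MT : 0 <= M * T * 2.
    by rewrite !mulr_ge0// ltW// (reduced_bound_gt0 a c T0 (ltW Cs0) hk1 hk2 hk3 hk4).
  rewrite ler_pdivlMr//; apply: le_trans (ltW (archi_boundP MT)) _.
  by rewrite ler_nat.
have CstE : Cst = 2 * (2 ^+ N * Cs) by [].
have weak f g x y t : norm_integrable `[0, T] x -> 0 <= t <= T ->
    y = S (riesz f, riesz g) ->
    system_at a b c k1 k2 k3 k4 f g x t <->
    is_weak_integral `[0, t] (fun s => G t s (x s)) (x t - y).
  by move=> ix t0T ->; exact: (system_at_weak_integral T0 (ltW Cs0) hk1 hk2 hk3 hk4).
(* The bound is proved for an arbitrary solution because the estimates of the components quantify
   over all solutions. *)
have bound f g u p : inL1 T f -> inL1 T g ->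
    volterra_solution T a b c k1 k2 k3 k4 f g u p ->
    (L1norm T u + L1norm T p <= Cst%:E * (L1norm T f + L1norm T g))%E.
  move=> hf hg /solution_representative[x [ix xup sys]].
  have [y [iy yE yle]] := data_representative (ltW Cs0) Sn hf hg.
  have xy := reduced_a_priori T0 (ltW Cs0) hk1 hk2 hk3 hk4 Sn ix iy _ (ltn0Sn _) MN.
  have {}xy : \int[@lebesgue_measure R]_(t in `[0, T]) `|x t| <=
      2 ^+ N * \int[@lebesgue_measure R]_(t in `[0, T]) `|y t|.
    apply: xy; apply: aeS (aeI sys yE) => t [syst yt] t0T.
    by apply/(weak _ _ _ _ _ ix t0T (yt t0T)); exact: syst.
  have [_ jx] := ix.
  have ux : (L1norm T u <= L1norm T x)%E.
    by apply: L1norm_ae_le; apply: aeS xup => t h /h ->; exact: (hprod_norm1 (u t, p t)).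
  have px : (L1norm T p <= L1norm T x)%E.
    by apply: L1norm_ae_le; apply: aeS xup => t h /h ->; exact: (hprod_norm2 (u t, p t)).
  apply: le_trans (leeD ux px) _; rewrite L1normE// -EFinD.
  apply: (@le_trans _ _ ((2 * 2 ^+ N)%:E *
      (\int[@lebesgue_measure R]_(t in `[0, T]) `|y t|)%:E)%E).
    by rewrite -EFinM lee_fin -mulrA mulr_natl mulr2n lerD.
  rewrite CstE mulrA (EFinM (2 * 2 ^+ N)) -muleA; exact: lee_wpmul2l.
split=> //; split=> [f g hf hg|].
  have [y [iy yE yle]] := data_representative (ltW Cs0) Sn hf hg.
  have [x ix xweak] := reduced_exists a c T0 (ltW Cs0) hk1 hk2 hk3 hk4 Sn iy.
  have [hx jx] := ix.
  have sol : volterra_solution T a b c k1 k2 k3 k4 f g (fun t => (x t).1) (fun t => (x t).2).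
    split.
      split.
        apply: simple_limit_strongly_measurable; apply: simple_limit_pair.
          apply: (simple_limit_comp hx (L := (fst : hprod V Q -> V))).
          apply: (@additive_bounded_continuous _ _ _ (fst : hprod V Q -> V) 1) => // z.
          by rewrite mul1r; exact: hprod_norm1.
        apply: (simple_limit_comp hx (L := (snd : hprod V Q -> Q))).
        apply: (@additive_bounded_continuous _ _ _ (snd : hprod V Q -> Q) 1) => // z.
        by rewrite mul1r; exact: hprod_norm2.
      apply: (@le_lt_trans _ _ (L1norm T x)); last by rewrite L1normE// ltry.
      apply: L1norm_ae_le; apply: aeW => t _.
      by rewrite [leLHS]/Num.norm/= ge_max hprod_norm1 hprod_norm2.
    apply: aeS yE => t yt t0T.
    exact: (weak _ _ _ _ _ ix t0T (yt t0T)).2 (xweak t t0T).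
  exists (fun t => (x t).1), (fun t => (x t).2); split=> //; last exact: bound.
  move=> u' p' /solution_representative[x' [ix' xup sys]].
  have wx : {ae @lebesgue_measure R, forall t, 0 <= t <= T ->
      is_weak_integral `[0, t] (fun s => G t s (x s)) (x t - y t)} by apply: aeW.
  have wx' : {ae @lebesgue_measure R, forall t, 0 <= t <= T ->
      is_weak_integral `[0, t] (fun s => G t s (x' s)) (x' t - y t)}.
    apply: aeS (aeI sys yE) => t [syst yt] t0T.
    by apply/(weak _ _ _ _ _ ix' t0T (yt t0T)); exact: syst.
  have xx' := reduced_unique T0 (ltW Cs0) hk1 hk2 hk3 hk4 Sn ix ix' wx wx'.
  apply: aeS (aeI xx' xup) => t [h1 h2] t0T.
  by rewrite -(h1 t0T) (h2 t0T).
(* One constant serves sixteen times: projections do not increase norms on the left, and on the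
   right the norms of [f] and [g] are at most the sums of the norms of their parts. *)
exists (fun=> Cst); split=> // f g hf hg u p sol ub u0 pb p0 fb f0 gb g0.
have up := bound _ _ _ _ hf hg sol.
have L0 (B : normedModType R) (h : R -> B) : (0 <= L1norm T h)%E.
  by apply: integral_ge0 => t _; rewrite lee_fin.
have le_proj (W : hilbertType R) (K' : csubspace W) (w : R -> W) :
    (L1norm T (fun t => orth_proj K' (w t)) <= L1norm T w)%E.
  by apply: L1norm_ae_le; apply: aeW => t _; exact: proj_norm.
have data : (Cst%:E * (L1norm T f + L1norm T g) <= Cst%:E * L1norm T fb +
    Cst%:E * L1norm T f0 + Cst%:E * L1norm T gb + Cst%:E * L1norm T g0)%E.
  have h1 := adde_ge0 (L0 _ fb) (L0 _ f0); have h2 := adde_ge0 h1 (L0 _ gb).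
  rewrite -!ge0_muleDr//; apply: lee_wpmul2l; first by rewrite lee_fin ltW.
  by rewrite -[leRHS]addeA; exact: (leeD (L1norm_dual_part K hf) (L1norm_dual_part H hg)).
have le_u : (L1norm T u <= Cst%:E * (L1norm T f + L1norm T g))%E.
  by apply: le_trans up; rewrite leeDl.
have le_p : (L1norm T p <= Cst%:E * (L1norm T f + L1norm T g))%E.
  by apply: le_trans up; rewrite leeDr.
by split; apply: le_trans (le_proj _ _ _) (le_trans _ data).
Qed.
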